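(* Let $n\ge 5$, let $\mathfrak g=\mathfrak{so}(2n,\mathbb C)$ and let $\mathfrak q=\mathfrak l\oplus\mathfrak n$ be the maximal parabolic subalgebra determined by the simple root $\alpha_{n-2}$ (type $D_n(n-2)$). Let $\mu=\varepsilon_1+\varepsilon_{n-1}$ (the highest weight of $\mathfrak g(1)$), and let $\epsilon$ be one of $\epsilon_\gamma=\varepsilon_1-\varepsilon_{n-1}$, $\epsilon^+_{n\gamma}=\varepsilon_2+\varepsilon_n$, $\epsilon^-_{n\gamma}=\varepsilon_2-\varepsilon_n$, so that $V(\mu+\epsilon)$ is one of the irreducible $\mathfrak l$-constituents $V(2\varepsilon_1)$, $V(\varepsilon_1+\varepsilon_2+\varepsilon_{n-1}+\varepsilon_n)$, $V(\varepsilon_1+\varepsilon_2+\varepsilon_{n-1}-\varepsilon_n)$ of $\mathfrak l\otimes\mathfrak z(\mathfrak n)$. Then the $\Omega_2|_{V(\mu+\epsilon)^*}$ system is conformally invariant on $\mathcal L_s$ if and only if $$ s=\frac{|\Delta_{\mu+\epsilon}(\mathfrak g(1))|}{2}-1, $$ where $\Delta_{\nu}(\mathfrak g(1))=\{\alpha\in\Delta(\mathfrak g(1)) : \nu-\alpha\in\Delta\}$ and $|\cdot|$ denotes cardinality.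
   Context: General setting. $\mathfrak g$ is a complex simple Lie algebra with Cartan subalgebra $\mathfrak h$, root system $\Delta$, positive system $\Delta^+$, simple roots $\Pi=\{\alpha_1,\dots,\alpha_n\}$ (Bourbaki labelling), Killing form $\kappa$, and $\rho$ half the sum of positive roots; for $\alpha\in\Delta$ fix root vectors $X_\alpha$. For a subspace $W\subset\mathfrak g$, $\Delta(W)$ is the set of roots whose root spaces lie in $W$. For a simple root $\alpha_{\mathfrak q}$, $\mathfrak q=\mathfrak l\oplus\mathfrak n$ is the standard maximal parabolic subalgebra with $\mathfrak l=\mathfrak h\oplus\bigoplus\{\mathfrak g_\alpha:\alpha\in\Delta\cap\mathrm{span}(\Pi\setminus\{\alpha_{\mathfrak q}\})\}$ and $\mathfrak n$ the sum of the remaining positive root spaces; $\lambda_{\mathfrak q}$ is the fundamental weight of $\alpha_{\mathfrak q}$. In the case at hand $\mathfrak n$ is two-step nilpotent and the eigenspaces of $\mathrm{ad}(H_{\mathfrak q})$, where $\beta(H_{\mathfrak q})=2\langle\lambda_{\mathfrak q},\beta\rangle/\|\alpha_{\mathfrak q}\|^2$, give a grading $\mathfrak g=\bigoplus_{j=-2}^2\mathfrak g(j)$ with $\mathfrak l=\mathfrak g(0)$, $\mathfrak n=\mathfrak g(1)\oplus\mathfrak g(2)$, $\mathfrak z(\mathfrak n)=\mathfrak g(2)$, $\bar{\mathfrak n}=\mathfrak g(-1)\oplus\mathfrak g(-2)$, $\mathfrak z(\bar{\mathfrak n})=\mathfrak g(-2)$. $V(\nu)$ denotes the simple $\mathfrak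 l$-module of highest weight $\nu$. Construction. Let $\omega=\sum_{\gamma_j\in\Delta(\mathfrak z(\mathfrak n))}X^*_{\gamma_j}\otimes X_{\gamma_j}$, where $X^*_{\gamma_j}\in\mathfrak g_{-\gamma_j}$ satisfies $\kappa(X^*_{\gamma_j},X_{\gamma_t})=\delta_{jt}$, and $\tau_2:\mathfrak g(1)\to\mathfrak l\otimes\mathfrak z(\mathfrak n)$, $\tau_2(X)=\tfrac12(\mathrm{ad}(X)^2\otimes\mathrm{Id})\omega$. For an irreducible $\mathfrak l$-constituent $W$ of $\mathfrak l\otimes\mathfrak z(\mathfrak n)$, realize its dual $W^*$ inside $\mathfrak l\otimes\mathfrak z(\bar{\mathfrak n})$ via $\kappa$ (with $(A\otimes B)(C\otimes D)=\kappa(A,C)\kappa(B,D)$) and define $\tilde\tau_2|_{W^*}:W^*\to\mathcal P^2(\mathfrak g(1))$ by $\tilde\tau_2(Y^* )(X)=Y^*(\tau_2(X))$. Identifying $\mathcal P^2(\mathfrak g(1))\cong\mathrm{Sym}^2(\mathfrak g(-1))$ via $\kappa$ and letting $\sigma:\mathrm{Sym}^2(\mathfrak g(-1))\to\mathcal U(\bar{\mathfrak n})$ be symmetrization, put $\omega_2|_{W^*}=\sigma\circ\tilde\tau_2|_{W^*}$. The $\Omega_2|_{W^*}$ system is the system of differential operators $R(\omega_2(Y^* ))$, $Y^*$ running over a basis of $W^*$, acting on sections of the line bundle $\mathcal L_s$ ($s\in\mathbb C$) over $\bar N_0$ (the restriction to the open cell $\bar N_0Q_0/Q_0$ of the line bundle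 on $G_0/Q_0$ induced by the character $|\chi_{\mathfrak q}|^s$ of $Q_0$ with differential $s\lambda_{\mathfrak q}$), $R$ the infinitesimal right translation. Let $\mathbb C_{-s}$ be the one-dimensional $\mathfrak q$-module with $\mathfrak h$ acting by $-s\lambda_{\mathfrak q}$ and $[\mathfrak l,\mathfrak l]+\mathfrak n$ acting by $0$, $M_{\mathfrak q}[\mathbb C_{-s}]=\mathcal U(\mathfrak g)\otimes_{\mathcal U(\mathfrak q)}\mathbb C_{-s}$ with generator $1_{-s}$. By a theorem of Barchini–Kable–Zierau (which may be taken as the definition here), the $\Omega_2|_{W^*}$ system is conformally invariant on $\mathcal L_s$ if and only if $X\cdot(\omega_2(Y^* )\otimes 1_{-s})=0$ in $M_{\mathfrak q}[\mathbb C_{-s}]$ for all $X\in\mathfrak n$ and $Y^*\in W^*$. Type $D_n$ data: roots $\pm\varepsilon_j\pm\varepsilon_k$ ($j<k$), $\alpha_j=\varepsilon_j-\varepsilon_{j+1}$ ($j<n$), $\alpha_n=\varepsilon_{n-1}+\varepsilon_n$; here $\alpha_{\mathfrak q}=\alpha_{n-2}$, $\Delta(\mathfrak g(1))=\{\varepsilon_j\pm\varepsilon_k: 1\le j\le n-2,\ k\in\{n-1,n\}\}$, $\Delta(\mathfrak z(\mathfrak n))=\{\varepsilon_j+\varepsilon_k:1\le j<k\le n-2\}$. *)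

(* Defs.v *)
From HB Require Import structures.
From mathcomp Require Import all_boot all_order all_algebra.
Set Implicit Arguments.
Unset Strict Implicit.
Unset Printing Implicit Defensive.
Import Order.TTheory GRing.Theory Num.Theory.
Local Open Scope ring_scope.

Section DnSetting.
Variables (C : numClosedFieldType) (n : nat).

(* Weights: integer vectors w.r.t. epsilon_1,...,epsilon_n             *)
Definition weight := {ffun 'I_n -> int}.

(* epsilon_k, 1-indexed: ee k = epsilon_k *)
Definition ee (k : nat) : weight := [ffun i : 'I_n => ((i : nat) == k.-1)%:Z].

Definition isRoot (a : weight) : bool :=
  [exists j : 'I_n, exists k : 'I_n, (j < k)%N &&
     [|| a == ee j.+1 + ee k.+1, a == ee j.+1 - ee k.+1,
         a == - ee j.+1 + ee k.+1 | a == - ee j.+1 - ee k.+1]].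

Definition isPosRoot (a : weight) : bool :=
  [exists j : 'I_n, exists k : 'I_n, (j < k)%N &&
     ((a == ee j.+1 + ee k.+1) || (a == ee j.+1 - ee k.+1))].

Definition Dg1 : seq weight :=
  undup (flatten [seq flatten [seq [seq ee j + (if b then ee k else - ee k)
                                    | b <- [:: true; false]]
                               | k <- [:: (n - 1)%N; n]]
                  | j <- iota 1 (n - 2)]).

Definition Delta_nu (nu : weight) : seq weight := [seq a <- Dg1 | isRoot (nu - a)].

(* lambda_q = fundamental weight of alpha_{n-2} = e_1 + ... + e_{n-2} *)
Definition lambda_q : weight := \sum_(1 <= j < n.-1) ee j.

Definition mu : weight := ee 1 + ee (n - 1).

Definition epsi (i : 'I_3) : weight :=
  match (i : nat) with
  | 0 => ee 1 - ee (n - 1)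
  | 1 => ee 2 + ee n
  | _ => ee 2 - ee n
  end.

(* Index p < n corresponds to e_{p+1}, index n + p to -e_{p+1}.        *)
Definition N := (n + n)%N.
Definition Mat := 'M[C]_N.

Definition Jform : Mat :=
  \matrix_(i < N, j < N) ((((i : nat) == j + n)%N || ((j : nat) == i + n)%N)%:R).

Definition so2n (A : Mat) : bool := A^T *m Jform + Jform *m A == 0.

Definition lie (A B : Mat) : Mat := A *m B - B *m A.

(* Killing form of so(2n):  kappa(A,B) = tr(ad A ad B) = (2n-2) tr(AB) *)
Definition kill (A B : Mat) : C := (n + n - 2)%:R * \tr (A *m B).

Definition inh (H : Mat) : bool := so2n H && is_diag_mx H.

(* evaluation nu(H) of a weight on H = diag(a_1..a_n,-a_1..-a_n) *)
Definition evw (a : weight) (H : Mat) : C :=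
  \sum_(i < n) (a i)%:~R * H (lshift n i) (lshift n i).

(* the element of h dual to a weight a (standard inner product, |alpha|^2 = 2) *)
Definition cartan_of (a : weight) : Mat :=
  diag_mx (\row_(p < N) match split p with
                        | inl i => (a i)%:~R
                        | inr i => - (a i)%:~R end).

(* H_q : beta(H_q) = 2<lambda_q,beta>/|alpha_q|^2 = <lambda_q,beta> *)
Definition Hq : Mat := cartan_of lambda_q.

Definition gr (j : int) (A : Mat) : bool := so2n A && (lie Hq A == j%:~R *: A).

Definition in_l (A : Mat) : bool := gr 0 A.
Definition in_n (X : Mat) : Prop :=
  exists X1 X2, gr 1 X1 /\ gr 2 X2 /\ X = X1 + X2.

Definition rootsp (a : weight) (Z : Mat) : Prop :=
  so2n Z /\ forall H, inh H -> lie H Z = evw a H *: Z.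

(* Explicit root vectors for the roots e_{j+1} +- e_{k+1}, j < k      *)
(* (0-indexed j, k);  b = true: plus sign, b = false: minus sign.     *)
Definition posvec (j k : 'I_n) (b : bool) : Mat :=
  if b then delta_mx (lshift n j) (rshift n k) - delta_mx (lshift n k) (rshift n j)
  else delta_mx (lshift n j) (lshift n k) - delta_mx (rshift n k) (rshift n j).

Definition negvec (j k : 'I_n) (b : bool) : Mat :=
  if b then delta_mx (rshift n k) (lshift n j) - delta_mx (rshift n j) (lshift n k)
  else delta_mx (lshift n k) (lshift n j) - delta_mx (rshift n j) (rshift n k).

(* X^*_gamma in g_{-gamma} with kappa(X^*_gamma, X_gamma) = 1 *)
Definition dualneg (j k : 'I_n) (b : bool) : Mat :=
  (kill (negvec j k b) (posvec j k b))^-1 *: negvec j k b.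

(* index set of Delta(g(1)) : j < n-2 <= k (0-indexed) *)
Definition in_g1idx (j k : 'I_n) : bool := (j < n - 2)%N && (n - 2 <= k)%N.
(* index set of Delta(z(n)) : j < k < n-2 (0-indexed) *)
Definition in_znidx (j k : 'I_n) : bool := (j < k)%N && (k < n - 2)%N.

(* Tensors in gl(2n) (x) gl(2n), encoded as (N*N) x (N*N) matrices:    *)
(*   tens A B = (mxvec A)^T (mxvec B), entry ((i,j),(k,l)) = A_ij B_kl  *)
Definition Tens := 'M[C]_(N * N).

Definition tens (A B : Mat) : Tens := (mxvec A)^T *m mxvec B.

(* (A (x) B)(C (x) D) = kappa(A,C) kappa(B,D), extended bilinearly *)
Definition pairT (T S : Tens) : C :=
  (n + n - 2)%:R ^+ 2 *
  \sum_(i < N) \sum_(j < N) \sum_(k < N) \sum_(l < N)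
     T (mxvec_index i j) (mxvec_index k l) * S (mxvec_index j i) (mxvec_index l k).

(* action of Z on tensors: ad Z (x) 1 + 1 (x) ad Z *)
Definition adm (Z : Mat) : 'M[C]_(N * N) := lin_mx (lie Z).
Definition actT (Z : Mat) (T : Tens) : Tens := (adm Z)^T *m T + T *m adm Z.

(* the subspace l (x) z(nbar),  z(nbar) = g(-2) *)
Definition in_l_zbar (T : Tens) : Prop :=
  exists s : seq (Mat * Mat),
    all (fun p => gr 0 p.1 && gr (-2) p.2) s /\ T = \sum_(p <- s) tens p.1 p.2.

Definition lowW (nu : weight) (T : Tens) : Prop :=
  in_l_zbar T /\
  (forall H, inh H -> actT H T = evw (- nu) H *: T) /\
  (forall a Z, isPosRoot a -> rootsp (- a) Z -> in_l Z -> actT Z T = 0).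

(* V(nu)^* realized in l (x) z(nbar): the l-submodule generated by its
   lowest weight vectors (of weight -nu) *)
Definition Wstar (nu : weight) (T : Tens) : Prop :=
  forall P : Tens -> Prop,
    P 0 -> (forall a U W, P U -> P W -> P (a *: U + W)) ->
    (forall Z U, in_l Z -> P U -> P (actT Z U)) ->
    (forall U, lowW nu U -> P U) -> P T.

(* omega = sum_{gamma in Delta(z(n))} X^*_gamma (x) X_gamma;
   tau_2(X) = 1/2 ((ad X)^2 (x) Id) omega *)
Definition tau2 (X : Mat) : Tens :=
  2%:R^-1 *: \sum_(j < n) \sum_(k < n | in_znidx j k)
     tens (lie X (lie X (dualneg j k true))) (posvec j k true).

Definition ttau2 (Y : Tens) (X : Mat) : C := pairT Y (tau2 X).

Definition Bpol (Y : Tens) (X X' : Mat) : C :=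
  (ttau2 Y (X + X') - ttau2 Y X - ttau2 Y X') / 2%:R.

(* Action of omega_2(Y^* ) = sigma(tilde tau_2(Y^* )) in U(nbar) on a vector v of a
   g-module rho:  with {X_a} the root-vector basis of g(1) and {X^*_a} the
   kappa-dual basis of g(-1), the element of Sym^2(g(-1)) corresponding to
   tilde tau_2(Y^* ) is sum_{a,b} B(X_a,X_b) X^*_a X^*_b, whose symmetrization is
   sum_{a,b} B(X_a,X_b) X^*_a X^*_b in U(nbar) (B symmetric). *)
Definition omega2_act (V : lmodType C) (rho : Mat -> V -> V) (Y : Tens) (v : V) : V :=
  \sum_(j < n) \sum_(k < n | in_g1idx j k) \sum_(b : bool)
  \sum_(j' < n) \sum_(k' < n | in_g1idx j' k') \sum_(b' : bool)
    Bpol Y (posvec j k b) (posvec j' k' b') *: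
      rho (dualneg j k b) (rho (dualneg j' k' b') v).

Definition is_gmod (V : lmodType C) (rho : Mat -> V -> V) : Prop :=
  (forall A, so2n A -> forall (a : C) (u w : V), rho A (a *: u + w) = a *: rho A u + rho A w) /\
  (forall A B (a : C) (u : V), so2n A -> so2n B -> rho (a *: A + B) u = a *: rho A u + rho B u) /\
  (forall A B (u : V), so2n A -> so2n B -> rho (lie A B) u = rho A (rho B u) - rho B (rho A u)).

(* q acts on v0 through C_{-s}: h by -s lambda_q, [l,l] + n by 0 *)
Definition is_Cms_vec (s : C) (V : lmodType C) (rho : Mat -> V -> V) (v0 : V) : Prop :=
  (forall H, inh H -> rho H v0 = (- s * evw lambda_q H) *: v0) /\
  (forall A B, in_l A -> in_l B -> rho (lie A B) v0 = 0) /\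
  (forall Z, in_n Z -> rho Z v0 = 0).

(* Conformal invariance of the Omega_2|_{V(nu)^*} system on L_s (BKZ criterion):
   X . (omega_2(Y^* ) (x) 1_{-s}) = 0 in M_q[C_{-s}] for all X in n, Y^* in W^*.
   Vanishing of u (x) 1_{-s} in M_q[C_{-s}] = U(g) (x)_{U(q)} C_{-s} is expressed
   through its universal property: u . v0 = 0 for every g-module V and every
   v0 in V on which q acts by the character of C_{-s}. *)
Definition conf_inv (s : C) (nu : weight) : Prop :=
  forall Y, Wstar nu Y -> forall X, in_n X ->
  forall (V : lmodType C) (rho : Mat -> V -> V) (v0 : V),
    is_gmod rho -> is_Cms_vec s rho v0 -> rho X (omega2_act rho Y v0) = 0.

End DnSetting.

(* Main.v *)
Require Import Defs.
From HB Require Import structures.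
From mathcomp Require Import all_boot all_order all_algebra.
From mathcomp Require Import zify ring.
From mathcomp.multinomials Require Import mpoly.
Import Order.TTheory GRing.Theory Num.Theory.
Local Open Scope ring_scope.
Set Implicit Arguments.
Unset Strict Implicit.
Unset Printing Implicit Defensive.

(* On l (x) z(nbar) the form polarising tau_2 is l-equivariant, so the vectors
   omega_2(Y) killed by n are stable under l, and it suffices to treat lowest
   weight tensors Y.  The weight of Y and a single lowering operator determine
   its form up to a scalar, so that with f(q, j) the root vectors of g(-1),
     omega_2(Y) v0 ~ sum_q f(q,1) f(-q,1) v0           for 2 eps_1,
     omega_2(Y) v0 ~ (f(a,1) f(b,2) - f(b,1) f(a,2)) v0  for the other two,
   where -a = eps_(n-1) and -b = eps_n or - eps_n.  Commuting a root vector of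
   g(1) through these elements yields a multiple of 1 - s times vectors f(q, j) v0.
   Hence s = 1 suffices, and 1 is the announced value since four roots are counted.
   Conversely the scalar is nonzero for explicit lowest weight tensors, and s = 1
   is forced as soon as some module of type C_(-s) has f(q, j) v0 <> 0: such a
   module consists of polynomials in the affine coordinates of two copies of a
   Grassmannian, with v0 = 1, carrying the characters s - 1 and 1. *)

(** The Levi factor is gl(n-2) + so(4), and g(1) is the tensor product of C^(n-2) with C^4. Hence
    Sym^2 g(-1) is the sum of Sym^2 (x) Sym^2 and wedge^2 (x) wedge^2 of the dual factors. The
    constituent for 2 eps_1 lies in the first summand, against the so(4)-invariant quadratic form;
    the other two lie in the second, against the two halves of wedge^2 C^4. This accounts for the
    two shapes of omega_2(Y) v0. The factor 1 - s has two origins: 4 - 2(1 + s) = 2(1 - s) with 4 =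
    dim C^4 for the quadratic form, and a bracket in l against the character for wedge^2. Invariance
    is a statement about all modules of type C_(-s), so the sufficiency of s = 1 is pure
    commutation, whereas its necessity requires a witness module. No basis of the generalised Verma
    module is needed for that: after one application of g(1) only first-order vectors remain, so a
    module in which these survive is enough. *)

(** * Root vectors of so(2n) *)

Section Indices.
Variable n : nat.
Implicit Types p q r t : 'I_(n + n).

(* Index [p < n] stands for eps_(p+1) and [n + p] for -eps_(p+1). *)
Definition cj p : 'I_(n + n) :=
  match split p with inl i => rshift n i | inr i => lshift n i end.

Definition wt p : weight n :=
  match split p with inl i => ee n i.+1 | inr i => - ee n i.+1 end.

(** The eigenvalue of H_q on the p-th basis vector of C^(2n). Degree 0, singled out by [mid], is the
    C^4 on which so(4) acts. *)
Definition deg p : int :=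
  match split p with inl i => (i < n - 2)%N%:Z | inr i => - (i < n - 2)%N%:Z end.

Definition mid p : bool := deg p == 0.

Lemma splitl (j : 'I_n) : split (lshift n j) = inl j :> 'I_n + 'I_n.
Proof. exact: (@unsplitK n n (inl j)). Qed.

Lemma splitr (j : 'I_n) : split (rshift n j) = inr j :> 'I_n + 'I_n.
Proof. exact: (@unsplitK n n (inr j)). Qed.

Lemma cjl j : cj (lshift n j) = rshift n j. Proof. by rewrite /cj splitl. Qed.
Lemma cjr j : cj (rshift n j) = lshift n j. Proof. by rewrite /cj splitr. Qed.
Lemma degl j : deg (lshift n j) = (j < n - 2)%N%:Z. Proof. by rewrite /deg splitl. Qed.
Lemma degr j : deg (rshift n j) = - (j < n - 2)%N%:Z. Proof. by rewrite /deg splitr. Qed.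
Lemma wtl j : wt (lshift n j) = ee n j.+1. Proof. by rewrite /wt splitl. Qed.
Lemma wtr j : wt (rshift n j) = - ee n j.+1. Proof. by rewrite /wt splitr. Qed.

Lemma cjK : involutive cj.
Proof. by move=> p; case: (split_ordP p) => j ->; rewrite ?cjl ?cjr ?cjl. Qed.

Lemma cj_inj : injective cj. Proof. exact: inv_inj cjK. Qed.

Lemma cj_eq p q : (cj p == q) = (p == cj q).
Proof. by rewrite -(inj_eq cj_inj) cjK. Qed.

Lemma cj_neq p : (cj p == p) = false.
Proof. by case: (split_ordP p) => j ->; rewrite ?cjl ?cjr ?eq_lrshift ?eq_rlshift. Qed.

Lemma deg_cj p : deg (cj p) = - deg p.
Proof. by case: (split_ordP p) => j ->; rewrite ?cjl ?cjr ?degl ?degr ?opprK. Qed.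

Lemma wt_cj p : wt (cj p) = - wt p.
Proof. by case: (split_ordP p) => j ->; rewrite ?cjl ?cjr ?wtl ?wtr ?opprK. Qed.

Lemma mid_cj p : mid (cj p) = mid p.
Proof. by rewrite /mid deg_cj oppr_eq0. Qed.

Lemma eeE (j i : 'I_n) : ee n j.+1 i = (i == j)%:Z.
Proof. by rewrite ffunE. Qed.

Lemma lambda_qE (i : 'I_n) : lambda_q n i = (i < n - 2)%N%:Z.
Proof.
rewrite /lambda_q sum_ffunE.
under eq_bigr do rewrite ffunE.
have [lt_i|ge_i] := ltnP i (n - 2).
  (* [ee] is 1-indexed, so within the range j >= 1 the only nonzero summand at coordinate i is j = i
     + 1. *)
  rewrite (big_cat_nat (n := i.+1)) //=; last by lia.
  rewrite big_nat big1 => [|j /andP[j1 ji]]; last by apply/eqP; rewrite eqz_nat; case: eqP => //; lia.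
  rewrite add0r big_ltn; last by lia.
  rewrite eqxx big_nat big1 ?addr0 // => j /andP[j1 ji].
  by apply/eqP; rewrite eqz_nat; case: eqP => //; lia.
rewrite big_nat big1 // => j /andP[j1 ji].
by apply/eqP; rewrite eqz_nat; case: eqP => //; lia.
Qed.

Lemma mid_lF q (j : 'I_n) : mid q -> (j < n - 2)%N -> (q == lshift n j) = false.
Proof. by move=> mq lj; apply/eqP => eq_q; move: mq; rewrite eq_q /mid degl lj. Qed.

Lemma mid_rF q (j : 'I_n) : mid q -> (j < n - 2)%N -> (q == rshift n j) = false.
Proof. by move=> mq lj; apply/eqP => eq_q; move: mq; rewrite eq_q /mid degr lj. Qed.

End Indices.

Section RootVectors.
Variables (C : numClosedFieldType) (n : nat).
Implicit Types (p q r t : 'I_(n + n)) (A B X Y Z H : 'M[C]_(n + n)).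
Local Notation so2n := (@so2n C n).
Local Notation lie := (@lie C n).
Local Notation kill := (@kill C n).

(* Locked, so that rules for [rho (A - B)] do not unfold root vectors. *)
Definition rv p q : 'M[C]_(n + n) := locked (delta_mx p q - delta_mx (cj q) (cj p)).

Lemma rv_delta p q : rv p q = delta_mx p q - delta_mx (cj q) (cj p).
Proof. by rewrite /rv -lock. Qed.

Lemma rvE p q r t : rv p q r t = (r == p)%:R * (t == q)%:R - (r == cj q)%:R * (t == cj p)%:R.
Proof. by rewrite rv_delta !mxE -!mulnb !natrM. Qed.

(** Every root vector has two names; case analyses use this to fold the mirrored blocks of a matrix
    onto the others. *)
Lemma rv_cj p q : rv (cj q) (cj p) = - rv p q.
Proof. by rewrite !rv_delta !cjK opprB. Qed.

Lemma rv_cj0 p : rv p (cj p) = 0.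
Proof. by rewrite rv_delta cjK subrr. Qed.

Lemma JformE p q : Jform C n p q = (q == cj p)%:R.
Proof.
rewrite mxE; congr (_%:R); congr (nat_of_bool _).
case: (split_ordP p) => j ->; case: (split_ordP q) => k ->; rewrite ?cjl ?cjr ?eq_lrshift ?eq_rlshift
 ?eq_lshift ?eq_rshift /= -?val_eqE /=; move: (ltn_ord j) (ltn_ord k); lia.
Qed.

Lemma so2nP A : reflect (forall p q, A p q = - A (cj q) (cj p)) (so2n A).
Proof.
have E p q : (A^T *m Jform C n + Jform C n *m A) p q = A (cj q) p + A (cj p) q.
  rewrite !mxE; congr (_ + _).
    rewrite (bigD1 (cj q)) //= mxE JformE cjK eqxx mulr1 big1 ?addr0 // => r /negbTE neq.
    by rewrite JformE -cj_eq eq_sym neq mulr0.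
  rewrite (bigD1 (cj p)) //= JformE eqxx mul1r big1 ?addr0 // => r /negbTE neq.
  by rewrite JformE neq mul0r.
apply: (iffP eqP) => [/matrixP A0 p q|A0].
  by have := A0 (cj p) q; rewrite E !cjK mxE addrC => /eqP; rewrite addr_eq0 => /eqP.
by apply/matrixP => p q; rewrite E [X in X + _]A0 cjK mxE addNr.
Qed.

Lemma so_rv p q : so2n (rv p q).
Proof.
apply/so2nP => r t; rewrite !rvE opprB !cj_eq !cjK.
by rewrite mulrC [in X in _ - X]mulrC.
Qed.

Lemma so_lin a A B : so2n A -> so2n B -> so2n (a *: A + B).
Proof.
move=> /so2nP hA /so2nP hB; apply/so2nP => p q.
by rewrite !mxE hA hB mulrN opprD.
Qed.

Lemma so0 : so2n 0.
Proof. by apply/so2nP => p q; rewrite !mxE oppr0. Qed.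

Lemma so_scale a A : so2n A -> so2n (a *: A).
Proof. by move=> hA; rewrite -[_ *: _]addr0 so_lin ?so0. Qed.

Lemma soD A B : so2n A -> so2n B -> so2n (A + B).
Proof. by move=> hA; rewrite -[A]scale1r => hB; rewrite so_lin. Qed.

Lemma soN A : so2n A -> so2n (- A).
Proof. by rewrite -scaleN1r; apply: so_scale. Qed.

(** The pairs (p, q) and (cj q, cj p) name the same vector up to a sign, and the coefficients differ
    by the same sign, so each contribution is counted twice. *)
Lemma so_expand A : so2n A -> A = 2%:R^-1 *: \sum_p \sum_q A p q *: rv p q.
Proof.
move=> /so2nP hA.
have E : \sum_p \sum_q A p q *: delta_mx (cj q) (cj p) = - A.
  rewrite (matrix_sum_delta (- A)) (reindex_inj (@cj_inj n)) exchange_big /=.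
  rewrite (reindex_inj (@cj_inj n)); apply: eq_bigr => p _; apply: eq_bigr => q _.
  by rewrite !cjK mxE [in RHS]hA opprK.
transitivity (2%:R^-1 *: (A + A)).
  by rewrite -mulr2n -scaler_nat scalerA mulVf ?scale1r // pnatr_eq0.
congr (_ *: _); rewrite -{2}[A]opprK -E {1}[A]matrix_sum_delta -sumrB.
by apply: eq_bigr => p _; rewrite -sumrB; apply: eq_bigr => q _; rewrite rv_delta scalerBr.
Qed.

(** The guard [A p q != 0] lets a grading or weight condition on A limit the root vectors that have
    to be treated. *)
Lemma so_ind (P : 'M[C]_(n + n) -> Prop) A : so2n A -> P 0 ->
  (forall a U W, P U -> P W -> P (a *: U + W)) ->
  (forall p q, A p q != 0 -> P (rv p q)) -> P A.
Proof.
move=> hA P0 PD PM.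
have PS U W : P U -> P W -> P (U + W) by rewrite -{2}[U]scale1r; apply: PD.
rewrite (so_expand hA) -[X in P X]addr0; apply: (PD) => //.
apply: (big_ind P) => // p _; apply: (big_ind P) => // q _.
have [->|Apq] := eqVneq (A p q) 0; first by rewrite scale0r.
by rewrite -[X in P X]addr0; apply: PD => //; apply: PM.
Qed.

Lemma lieDr A a X Y : lie A (a *: X + Y) = a *: lie A X + lie A Y.
Proof. by rewrite /lie mulmxDr mulmxDl -scalemxAl -scalemxAr opprD scalerBr addrACA. Qed.

Lemma lieDl A a X Y : lie (a *: X + Y) A = a *: lie X A + lie Y A.
Proof. by rewrite /lie mulmxDr mulmxDl -scalemxAl -scalemxAr opprD scalerBr addrACA. Qed.

Lemma lie0r A : lie A 0 = 0. Proof. by rewrite /lie mulmx0 mul0mx subrr. Qed.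
Lemma lie0l A : lie 0 A = 0. Proof. by rewrite /lie mulmx0 mul0mx subrr. Qed.

Lemma lieC A B : lie A B = - lie B A. Proof. by rewrite /lie opprB. Qed.

Lemma lieNr A X : lie A (- X) = - lie A X.
Proof. by rewrite /lie mulmxN mulNmx opprB opprK addrC. Qed.

Lemma lieZr A a X : lie A (a *: X) = a *: lie A X.
Proof. by rewrite -[a *: X]addr0 lieDr lie0r addr0. Qed.

Lemma lie_addr A X Y : lie A (X + Y) = lie A X + lie A Y.
Proof. by rewrite -[X]scale1r lieDr !scale1r. Qed.

Lemma lie_sumr A (I : Type) (s : seq I) (P : pred I) (F : I -> 'M[C]_(n + n)) :
  lie A (\sum_(i <- s | P i) F i) = \sum_(i <- s | P i) lie A (F i).
Proof. by rewrite /lie mulmx_sumr mulmx_suml sumrB. Qed.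

Lemma jacobi Z A B : lie Z (lie A B) = lie (lie Z A) B + lie A (lie Z B).
Proof.
rewrite /lie !mulmxBr !mulmxBl !mulmxA !opprB.
move: (Z *m A *m B) (Z *m B *m A) (A *m B *m Z) (B *m A *m Z) (A *m Z *m B) (B *m Z *m A) => a b c d e f.
by apply/matrixP => p q; rewrite !mxE; ring.
Qed.

Lemma so_lie A B : so2n A -> so2n B -> so2n (lie A B).
Proof.
move=> /so2nP hA /so2nP hB; apply/so2nP => p q; rewrite !mxE opprB.
rewrite (reindex_inj (@cj_inj n)) /= [in X in _ - X](reindex_inj (@cj_inj n)) /=.
congr (_ - _); apply: eq_bigr => r _.
  by rewrite hA hB !cjK mulrNN mulrC.
by rewrite hA hB !cjK mulrNN mulrC.
Qed.

(** One formula for root vectors and Cartan elements alike; the last two terms come from the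
    products of a matrix unit with a mirrored one. *)
Lemma lie_rv p q r t : lie (rv p q) (rv r t) =
   (q == r)%:R *: rv p t - (t == p)%:R *: rv r q
   - (q == cj t)%:R *: rv p (cj r) + (p == cj r)%:R *: rv (cj t) q.
Proof.
have E a b c d : delta_mx a b *m delta_mx c d = (b == c)%:R *: delta_mx a d :> 'M[C]_(n + n).
  by rewrite mul_delta_mx_cond scaler_nat.
rewrite /lie !rv_delta !mulmxBr !mulmxBl !E !cjK !(inj_eq (@cj_inj n)).
rewrite (eq_sym p t) (eq_sym r q) (cj_eq p r) (eq_sym (cj r) p) (eq_sym t (cj q)) (cj_eq q t).
by apply/matrixP => a b; rewrite !mxE; ring.
Qed.

Lemma deg_diag p q : Hq C n p q = (deg p)%:~R *+ (p == q).
Proof.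
rewrite /Hq /cartan_of !mxE; congr (_ *+ _).
case: (split_ordP p) => j ->; rewrite ?splitl ?splitr ?degl ?degr lambda_qE //.
by rewrite rmorphN.
Qed.

Lemma lie_diag H A p q : is_diag_mx H -> lie H A p q = (H p p - H q q) * A p q.
Proof.
move=> /is_diag_mxP dH; rewrite !mxE (bigD1 p) //= big1 ?addr0; last first.
  by move=> r neq; rewrite dH ?mul0r // eq_sym.
rewrite (bigD1 q) //= big1 ?addr0; last by move=> r neq; rewrite dH ?mulr0.
by rewrite mulrBl [A _ _ * _]mulrC.
Qed.

Lemma lie_Hq A p q : lie (Hq C n) A p q = (deg p - deg q)%:~R * A p q.
Proof. by rewrite lie_diag ?diag_mx_is_diag // !deg_diag !eqxx rmorphB. Qed.

Lemma gr_so d A : gr d A -> so2n A. Proof. by case/andP. Qed.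

Lemma gr_entry d A p q : gr d A -> A p q != 0 -> deg p - deg q = d.
Proof.
case/andP=> _ /eqP/matrixP/(_ p q); rewrite lie_Hq mxE => /eqP; rewrite -subr_eq0 -mulrBl mulf_eq0.
by case/orP=> [|->//]; rewrite -rmorphB intr_eq0 subr_eq0 => /eqP.
Qed.

Lemma gr_lin d a A B : gr d A -> gr d B -> gr d (a *: A + B).
Proof.
case/andP=> sA /eqP hA /andP[sB /eqP hB]; rewrite /gr so_lin //= lieDr hA hB.
by rewrite scalerDr !scalerA mulrC.
Qed.

Lemma gr0 d : gr d (0 : 'M[C]_(n + n)).
Proof. by rewrite /gr so0 lie0r scaler0 eqxx. Qed.

Lemma gr_lie d e A B : gr d A -> gr e B -> gr (d + e) (lie A B).
Proof.
case/andP=> sA /eqP hA /andP[sB /eqP hB]; rewrite /gr so_lie //= jacobi hA hB.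
rewrite lieZr (lieC (_ *: A)) lieZr -scalerN -lieC -scalerDl rmorphD.
by rewrite eqxx.
Qed.

Lemma inh_rv p : inh (rv p p).
Proof.
rewrite /inh so_rv; apply/is_diag_mxP => r t neq0.
have neq : (t == r) = false by rewrite eq_sym; apply: negbTE neq0.
rewrite rvE; case: (eqVneq r p) => [er|_]; case: (eqVneq r (cj p)) => [er'|_] /=.
- by have := cj_neq p; rewrite -er' er eqxx.
- by rewrite -er neq mulr0 mul0r subr0.
- by rewrite -er' neq mulr0 mul0r subr0.
- by rewrite !mul0r subr0.
Qed.

Lemma inh_cj H p : inh H -> H (cj p) (cj p) = - H p p.
Proof. by case/andP=> /so2nP hH _; rewrite hH cjK. Qed.

Lemma lie_inh_rv H p q : inh H -> lie H (rv p q) = (H p p - H q q) *: rv p q.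
Proof.
move=> hH; have /andP[_ dH] := hH.
have E a b : lie H (delta_mx a b) = (H a a - H b b) *: delta_mx a b.
  apply/matrixP => r t; rewrite lie_diag // !mxE.
  by case: eqVneq => [->|_]; case: eqVneq => [->|_] //=; rewrite !mulr0.
by rewrite rv_delta lie_addr lieNr !E !inh_cj // opprK [- _ + H _ _]addrC scalerBr.
Qed.

Lemma evwD (a b : weight n) H : evw (a + b) H = evw a H + evw b H.
Proof. by rewrite /evw -big_split; apply: eq_bigr => i _; rewrite ffunE rmorphD mulrDl. Qed.

Lemma evwN (a : weight n) H : evw (- a) H = - evw a H.
Proof. by rewrite /evw -sumrN; apply: eq_bigr => i _; rewrite ffunE rmorphN mulNr. Qed.

Lemma evw_wt p H : inh H -> evw (wt p) H = H p p.
Proof.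
move=> hH; have E (j : 'I_n) : evw (ee n j.+1) H = H (lshift n j) (lshift n j).
  rewrite /evw (bigD1 j) //= eeE eqxx mul1r big1 ?addr0 // => i neq.
  by rewrite eeE (negbTE neq) mul0r.
case: (split_ordP p) => j ->; rewrite ?wtl ?wtr ?evwN E //.
by rewrite -cjl inh_cj.
Qed.

Lemma evw_rv (a : weight n) (i : 'I_n) : evw a (rv (lshift n i) (lshift n i)) = (a i)%:~R.
Proof.
rewrite /evw (bigD1 i) //= rvE cjl eqxx eq_lrshift mul0r subr0 !mulr1 big1 ?addr0 // => j neq.
by rewrite rvE cjl eq_lshift (negbTE neq) eq_lrshift !mul0r subr0 mulr0.
Qed.

Lemma rootsp_rv p q : rootsp (wt p - wt q) (rv p q).
Proof.
split=> [|H hH]; first exact: so_rv.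
by rewrite lie_inh_rv // evwD evwN !evw_wt.
Qed.

Lemma rootsp_entry (a : weight n) A p q : rootsp a A -> A p q != 0 -> wt p - wt q = a.
Proof.
case=> sA hA nz; apply/ffunP => i.
have hi := inh_rv (lshift n i); have /andP[_ di] := hi.
have /matrixP/(_ p q) := hA _ hi; rewrite lie_diag // [RHS]mxE -!evw_wt // -evwN -evwD !evw_rv.
by move/(mulIf nz)/intr_inj.
Qed.

Lemma inh_Hq : inh (Hq C n).
Proof.
rewrite /inh diag_mx_is_diag andbT; apply/so2nP => p q; rewrite !deg_diag (inj_eq (@cj_inj n)) deg_cj.
by rewrite eq_sym; case: eqVneq => [->|_]; rewrite ?mulr0n ?oppr0 // !mulr1n rmorphN opprK.
Qed.

Lemma gr_rv p q : gr (deg p - deg q) (rv p q).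
Proof. by rewrite /gr so_rv lie_inh_rv ?inh_Hq // !deg_diag !eqxx !mulr1n rmorphB eqxx. Qed.

Lemma gr_rvE d p q : deg p - deg q = d -> gr d (rv p q).
Proof. by move<-; apply: gr_rv. Qed.

Lemma inh_gr0 H : inh H -> gr 0 H.
Proof.
case/andP=> sH dH; rewrite /gr sH scale0r; apply/eqP/matrixP => p q; rewrite lie_Hq mxE.
have [->|neq] := eqVneq p q; first by rewrite subrr mul0r.
by move/is_diag_mxP: dH => ->; rewrite ?mulr0.
Qed.

(** The value of the Killing form on opposite root vectors: the trace form contributes the 2, since
    a root vector consists of two matrix units. *)
Definition kap : C := (n + n - 2)%:R * 2%:R.

Lemma killC A B : kill A B = kill B A.
Proof. by rewrite /kill mxtrace_mulC. Qed.

Lemma kill_lin A a X Y : kill A (a *: X + Y) = a * kill A X + kill A Y.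
Proof. by rewrite /kill mulmxDr linearD /= -scalemxAr linearZ /= mulrDr mulrCA. Qed.

Lemma kill0 A : kill A 0 = 0.
Proof. by rewrite /kill mulmx0 linear0 mulr0. Qed.

Lemma kill_sum A (I : Type) (s : seq I) (P : pred I) (F : I -> 'M[C]_(n + n)) :
  kill A (\sum_(i <- s | P i) F i) = \sum_(i <- s | P i) kill A (F i).
Proof. by rewrite /kill mulmx_sumr linear_sum mulr_sumr. Qed.

Lemma kill_inv Z A B : kill (lie Z A) B = - kill A (lie Z B).
Proof.
rewrite /kill -mulrN; congr (_ * _).
rewrite /lie mulmxBl mulmxBr !linearB /= opprB -[Z *m A *m B]mulmxA mxtrace_mulC.
by rewrite -!mulmxA.
Qed.

Lemma kill_rv A p q : so2n A -> kill A (rv p q) = kap * A q p.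
Proof.
move=> /so2nP hA; have E a b : \tr (A *m delta_mx a b) = A b a.
  rewrite /mxtrace (bigD1 b) //= big1 ?addr0 => [|r neq].
    rewrite mxE (bigD1 a) //= big1 ?addr0 ?mxE ?eqxx ?mulr1 // => r neq.
    by rewrite mxE (negbTE neq) mulr0.
  by rewrite mxE big1 // => t _; rewrite mxE (negbTE neq) andbF mulr0.
rewrite /kill rv_delta mulmxBr linearB /= !E [A (cj p) _]hA !cjK opprK /kap.
by rewrite -mulrA; congr (_ * _); rewrite mulr_natl mulr2n.
Qed.

End RootVectors.

(** * The grading *)

Section Grading.
Variables (C : numClosedFieldType) (n : nat).
Implicit Types (p q r t : 'I_(n + n)) (A B X Y Z H : 'M[C]_(n + n)).
Implicit Types (x y z : 'I_n * 'I_(n + n)).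
Local Notation so2n := (@so2n C n).
Local Notation lie := (@lie C n).
Local Notation kill := (@kill C n).
Local Notation rv := (@rv C n).

(** Eliminating this on both indices of a matrix entry turns a degree condition into a list of
    admissible blocks. *)
Variant deg_spec : 'I_(n + n) -> int -> bool -> Prop :=
  | DegL (j : 'I_n) of (j < n - 2)%N : deg_spec (lshift n j) 1 false
  | DegR (j : 'I_n) of (j < n - 2)%N : deg_spec (rshift n j) (-1) false
  | DegM p of mid p : deg_spec p 0 true.

Lemma degP p : deg_spec p (deg p) (mid p).
Proof.
have [mp|nmp] := boolP (mid p); first by rewrite (eqP mp); apply: DegM.
move: nmp; rewrite /mid; case: (split_ordP p) => j ->; rewrite ?degl ?degr;
  case lj: (j < n - 2)%N => // _; [exact: DegL|exact: DegR].
Qed.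

(** The decomposition of g(1) as C^(n-2) (x) C^4 at the level of bases: [xg] and [yg] over these
    pairs are bases of g(1) and g(-1), dual up to the factor [kap]. *)
Definition g1idx x : bool := (x.1 < n - 2)%N && mid x.2.
Definition xg x : 'M[C]_(n + n) := rv (lshift n x.1) x.2.
Definition yg x : 'M[C]_(n + n) := rv x.2 (lshift n x.1).
(** The plus sign selects the index of -eps_(k+1), because [rv p q] has weight [wt p - wt q]. *)
Definition sgn_idx (k : 'I_n) (b : bool) : 'I_(n + n) := if b then rshift n k else lshift n k.

Lemma posvecE (j k : 'I_n) b : posvec C j k b = rv (lshift n j) (sgn_idx k b).
Proof. by case: b; rewrite rv_delta /= ?cjl ?cjr. Qed.

Lemma negvecE (j k : 'I_n) b : negvec C j k b = rv (sgn_idx k b) (lshift n j).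
Proof. by case: b; rewrite rv_delta /= ?cjl ?cjr. Qed.

Lemma dualnegE (j k : 'I_n) b : j != k -> dualneg C j k b = (kap C n)^-1 *: rv (sgn_idx k b) (lshift n j).
Proof.
move=> /negbTE neq; rewrite /dualneg posvecE negvecE kill_rv ?so_rv // rvE !eqxx cjl.
by case: b => /=; rewrite ?eq_lrshift ?eq_rshift 1?eq_sym ?neq ?mul0r subr0 !mulr1.
Qed.

Lemma g1_sum (V : nmodType) (F : 'I_n -> 'I_(n + n) -> V) :
  \sum_(j < n) \sum_(k < n | in_g1idx j k) \sum_(b : bool) F j (sgn_idx k b) =
  \sum_(x | g1idx x) F x.1 x.2.
Proof.
rewrite -(pair_big_dep (fun j : 'I_n => (j < n - 2)%N) (fun _ q => mid q) F) /=.
rewrite [RHS]big_mkcond /=; apply: eq_bigr => j _.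
rewrite /in_g1idx; case: (j < n - 2)%N => /=; last by rewrite big_pred0.
rewrite [RHS]big_mkcond big_split_ord /= -big_split big_mkcond; apply: eq_bigr => k _ /=.
rewrite big_bool /mid degl degr ltnNge /= oppr_eq0; case: (n - 2 <= k)%N => //=.
  by rewrite addrC.
by rewrite addr0.
Qed.

Lemma xgE x y : g1idx x -> g1idx y -> xg x (lshift n y.1) y.2 = (y == x)%:R.
Proof.
case: x => j q; case: y => k r /andP[/= lj mq] /andP[/= lk mr].
by rewrite /xg rvE /= eq_lshift xpair_eqE -natrM mulnb cjl (mid_rF mr lj) mulr0 subr0.
Qed.

Lemma ygE x y : g1idx x -> g1idx y -> yg x y.2 (lshift n y.1) = (y == x)%:R.
Proof.
case: x => j q; case: y => k r /andP[/= lj mq] /andP[/= lk mr].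
by rewrite /yg rvE /= eq_lshift xpair_eqE -natrM mulnb cjl (mid_rF mr lj) mul0r subr0 andbC.
Qed.

Lemma g1_expand X : gr 1 X -> X = \sum_(x | g1idx x) X (lshift n x.1) x.2 *: xg x.
Proof.
move=> hX; pattern X; apply: (so_ind (gr_so hX)) => [|a U W eU eW|p q nz].
- by rewrite big1 // => x _; rewrite mxE scale0r.
- rewrite {1}eU {1}eW scaler_sumr -big_split; apply: eq_bigr => x _ /=.
  by rewrite !mxE scalerDl scalerA.
have E x : g1idx x -> xg x = \sum_(y | g1idx y) xg x (lshift n y.1) y.2 *: xg y.
  move=> gx; rewrite (bigD1 x) //= xgE // eqxx scale1r big1 ?addr0 // => y /andP[gy neq].
  by rewrite xgE // (negbTE neq) scale0r.
move: (gr_entry hX nz) => {nz}; case: (degP p) => [j lj|j lj|{}p mp]; case: (degP q) => [k lk|k lk|{}q mq] //= _.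
  by apply: (E (j, q)); rewrite /g1idx /= lj.
have -> : rv p (rshift n k) = - xg (k, cj p) by rewrite /xg -cjr rv_cj opprK.
rewrite {1}E; last by rewrite /g1idx /= lk mid_cj.
by rewrite -sumrN; apply: eq_bigr => y _; rewrite -scaleNr; congr (_ *: _); rewrite [RHS]mxE.
Qed.

Lemma gm1_expand X : gr (-1) X -> X = \sum_(x | g1idx x) X x.2 (lshift n x.1) *: yg x.
Proof.
move=> hX; pattern X; apply: (so_ind (gr_so hX)) => [|a U W eU eW|p q nz].
- by rewrite big1 // => x _; rewrite mxE scale0r.
- rewrite {1}eU {1}eW scaler_sumr -big_split; apply: eq_bigr => x _ /=.
  by rewrite !mxE scalerDl scalerA.
have E x : g1idx x -> yg x = \sum_(y | g1idx y) yg x y.2 (lshift n y.1) *: yg y.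
  move=> gx; rewrite (bigD1 x) //= ygE // eqxx scale1r big1 ?addr0 // => y /andP[gy neq].
  by rewrite ygE // (negbTE neq) scale0r.
move: (gr_entry hX nz) => {nz}; case: (degP p) => [j lj|j lj|{}p mp]; case: (degP q) => [k lk|k lk|{}q mq] //= _.
  have -> : rv (rshift n j) q = - yg (j, cj q) by rewrite /yg -cjr rv_cj opprK.
  rewrite {1}E; last by rewrite /g1idx /= lj mid_cj.
  by rewrite -sumrN; apply: eq_bigr => y _; rewrite -scaleNr; congr (_ *: _); rewrite [RHS]mxE.
by apply: (E (k, p)); rewrite /g1idx /= lk.
Qed.

Lemma gm2_expand B : gr (-2) B ->
  B = \sum_(j < n) \sum_(k < n | in_znidx j k)
        kill B (posvec C j k true) *: dualneg C j k true.
Proof.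
move=> hB; have sB := gr_so hB.
transitivity (\sum_(j < n) \sum_(k < n | in_znidx j k)
   B (rshift n k) (lshift n j) *: rv (rshift n k) (lshift n j)); last first.
  apply: eq_bigr => j _; apply: eq_bigr => k /andP[jk _].
  rewrite posvecE kill_rv // dualnegE -?val_eqE /= ?neq_ltn ?jk // scalerA.
  rewrite mulrAC divff ?mul1r // /kap mulf_neq0 // pnatr_eq0; move: (ltn_ord k); lia.
pattern B; apply: (so_ind sB) => [|a U W eU eW|p q nz].
- by rewrite big1 // => x _; rewrite big1 // => y _; rewrite mxE scale0r.
- rewrite {1}eU {1}eW scaler_sumr -big_split; apply: eq_bigr => x _ /=.
  rewrite scaler_sumr -big_split; apply: eq_bigr => y _ /=.
  by rewrite !mxE scalerDl scalerA.
have E (a b : 'I_n) : in_znidx b a -> rv (rshift n a) (lshift n b) =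
   \sum_(j < n) \sum_(k < n | in_znidx j k)
   rv (rshift n a) (lshift n b) (rshift n k) (lshift n j) *: rv (rshift n k) (lshift n j).
  move=> ba; rewrite (bigD1 b) //= (bigD1 a) //= !big1 ?addr0.
  - rewrite rvE !eqxx cjl cjr eq_rshift eq_lshift; case/andP: ba => ba _.
    by rewrite -val_eqE /= gtn_eqF // mul0r subr0 mulr1 scale1r.
  - move=> j /negbTE jb; rewrite big1 // => k /andP[jk _].
    rewrite rvE cjl cjr !eq_rshift !eq_lshift jb mulr0 sub0r.
    have [eka|_] := eqVneq k b; last by rewrite mul0r oppr0 scale0r.
    have [eja|_] := eqVneq j a; last by rewrite mulr0 oppr0 scale0r.
    by case/andP: ba; rewrite -eka -eja ltnNge ltnW.
  - move=> k /andP[/andP[bk _] /negbTE ka]; rewrite rvE cjl cjr !eq_rshift !eq_lshift ka mul0r.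
    by rewrite -val_eqE /= gtn_eqF // mul0r subr0 scale0r.
move: (gr_entry hB nz) => {nz}; case: (degP p) => [j lj|j lj|{}p mp]; case: (degP q) => [k lk|k lk|{}q mq] //= _.
have [kj|jk|/val_inj->] := ltngtP k j.
- by apply: E; rewrite /in_znidx kj.
- have e : rv (rshift n j) (lshift n k) = - rv (rshift n k) (lshift n j) by rewrite -rv_cj cjl cjr.
  rewrite e {1}E; last by rewrite /in_znidx jk.
  rewrite -sumrN; apply: eq_bigr => a _; rewrite -sumrN; apply: eq_bigr => b _.
  by rewrite -scaleNr; congr (_ *: _); rewrite [RHS]mxE.
- have -> : rv (rshift n j) (lshift n j) = 0 by rewrite -cjr rv_cj0.
  by rewrite big1 // => a _; rewrite big1 // => b _; rewrite mxE scale0r.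
Qed.

End Grading.

(** * The forms of tau_2 and their l-equivariance *)

Section Tensors.
Variables (C : numClosedFieldType) (n : nat).
Implicit Types (A B X Y Z H : 'M[C]_(n + n)) (T U W : Tens C n).
Local Notation so2n := (@so2n C n).
Local Notation lie := (@lie C n).
Local Notation kill := (@kill C n).
Local Notation rv := (@rv C n).

Lemma tensE A B i j k l :
  tens A B (mxvec_index i j) (mxvec_index k l) = A i j * B k l.
Proof. by rewrite mxE big_ord1 mxE !mxvecE. Qed.

Lemma pairT_lin a U W T : pairT (a *: U + W) T = a * pairT U T + pairT W T.
Proof.
rewrite /pairT mulrCA -mulrDr; congr (_ * _); rewrite mulr_sumr -big_split.
apply: eq_bigr => i _ /=; rewrite mulr_sumr -big_split.
apply: eq_bigr => j _ /=; rewrite mulr_sumr -big_split.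
apply: eq_bigr => k _ /=; rewrite mulr_sumr -big_split.
by apply: eq_bigr => l _ /=; rewrite !mxE mulrDl mulrA.
Qed.

Lemma pairTC U W : pairT U W = pairT W U.
Proof.
rewrite /pairT; congr (_ * _); rewrite exchange_big; apply: eq_bigr => j _; apply: eq_bigr => i _ /=.
by rewrite exchange_big; apply: eq_bigr => l _; apply: eq_bigr => k _ /=; rewrite mulrC.
Qed.

Lemma pairT_linr a U W T : pairT T (a *: U + W) = a * pairT T U + pairT T W.
Proof. by rewrite pairTC pairT_lin !(pairTC T). Qed.

Lemma pairT0 T : pairT 0 T = 0.
Proof.
rewrite /pairT big1 ?mulr0 // => i _; rewrite big1 // => j _; rewrite big1 // => k _.
by rewrite big1 // => l _; rewrite mxE mul0r.
Qed.

Lemma pairT_sumr T (I : Type) (s : seq I) (P : pred I) (F : I -> Tens C n) :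
  pairT T (\sum_(i <- s | P i) F i) = \sum_(i <- s | P i) pairT T (F i).
Proof.
elim/big_rec2: _ => [|i y U _ <-]; first by rewrite pairTC pairT0.
by rewrite -[F i]scale1r pairT_linr mul1r scale1r.
Qed.

Lemma pairT_scaler T a U : pairT T (a *: U) = a * pairT T U.
Proof. by rewrite -[a *: U]addr0 pairT_linr (pairTC _ 0) pairT0 addr0. Qed.

Lemma pairT_tens A B X Y : pairT (tens A B) (tens X Y) = kill A X * kill B Y.
Proof.
have E (U W : 'M[C]_(n + n)) : \tr (U *m W) = \sum_(i < n + n) \sum_(j < n + n) U i j * W j i :> C.
  by apply: eq_bigr => i _; rewrite mxE.
rewrite /pairT /kill mulrACA -expr2 !E; congr (_ * _).
rewrite mulr_suml; apply: eq_bigr => i _; rewrite mulr_suml; apply: eq_bigr => j _.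
rewrite mulr_sumr; apply: eq_bigr => k _; rewrite mulr_sumr; apply: eq_bigr => l _.
by rewrite !tensE mulrACA.
Qed.

Lemma kill_scale A a X : kill A (a *: X) = a * kill A X.
Proof. by rewrite -[a *: X]addr0 kill_lin kill0 addr0. Qed.

(** Pairing with omega contracts its z(n) leg against B; by [gm2_expand] this leaves B itself in the
    other leg, where (ad X)^2 acts. *)
Lemma ttau2_tens A B X : gr (-2) B ->
  ttau2 (tens A B) X = 2%:R^-1 * kill A (lie X (lie X B)).
Proof.
move=> hB; rewrite /ttau2 /tau2 pairT_scaler; congr (_ * _).
rewrite {2}(gm2_expand hB) !lie_sumr kill_sum pairT_sumr; apply: eq_bigr => j _.
rewrite !lie_sumr kill_sum pairT_sumr; apply: eq_bigr => k _.
by rewrite pairT_tens mulrC -kill_scale -!lieZr.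
Qed.

Definition bform T X Y : C := locked (Bpol T X Y).

Lemma bformE T X Y : bform T X Y = Bpol T X Y.
Proof. by rewrite /bform -lock. Qed.

(** The polarisation of X -> 1/2 kappa(A, (ad X)^2 B): one half is that of tau_2, the other that of
    polarising. *)
Definition quart A B X Y : C :=
  4%:R^-1 * (kill A (lie X (lie Y B)) + kill A (lie Y (lie X B))).

Lemma bform_tens A B X Y : gr (-2) B -> bform (tens A B) X Y = quart A B X Y.
Proof.
move=> hB; rewrite !bformE /Bpol !ttau2_tens // /quart.
have kD (U W : 'M[C]_(n + n)) : kill A (U + W) = kill A U + kill A W.
  by rewrite -[U in LHS]scale1r kill_lin mul1r.
have lD (U W : 'M[C]_(n + n)) Z : lie (U + W) Z = lie U Z + lie W Z.
  by rewrite -[U in LHS]scale1r lieDl scale1r.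
by rewrite !lD !lie_addr !kD; field.
Qed.

Lemma bform_lin a U W X Y : bform (a *: U + W) X Y = a * bform U X Y + bform W X Y.
Proof. rewrite !bformE /Bpol /ttau2 !pairT_lin.
by move: (pairT U _) (pairT U _) (pairT U _) (pairT W _) (pairT W _) (pairT W _) => *; field. Qed.

Lemma bformC T X Y : bform T X Y = bform T Y X.
Proof. rewrite !bformE /Bpol [Y + X]addrC.
by move: (ttau2 T _) (ttau2 T X) (ttau2 T Y) => a b c; rewrite addrAC. Qed.

Lemma bform0 X Y : bform (0 : Tens C n) X Y = 0.
Proof. by rewrite !bformE /Bpol /ttau2 !pairT0; field. Qed.

Lemma bform_sum (I : Type) (s : seq I) (F : I -> Tens C n) X Y :
  bform (\sum_(i <- s) F i) X Y = \sum_(i <- s) bform (F i) X Y.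
Proof.
elim/big_rec2: _ => [|i y U _ <-]; first by rewrite bform0.
by rewrite -[F i]scale1r bform_lin mul1r scale1r.
Qed.

Lemma bform_sum_tens (s : seq ('M[C]_(n + n) * 'M[C]_(n + n))) X Y :
  all (fun p => gr 0 p.1 && gr (-2) p.2) s ->
  bform (\sum_(p <- s) tens p.1 p.2) X Y = \sum_(p <- s) quart p.1 p.2 X Y.
Proof.
move=> /allP hs; rewrite bform_sum; apply: eq_big_seq => p /hs /andP[_ h].
exact: bform_tens.
Qed.

Lemma bform_linl T a X X' Y : in_l_zbar T ->
  bform T (a *: X + X') Y = a * bform T X Y + bform T X' Y.
Proof.
case=> s [hs ->]; rewrite !bform_sum_tens // mulr_sumr -big_split; apply: eq_bigr => p _ /=.
by rewrite /quart !lieDl !lieDr !kill_lin; do !move: (kill _ _) => ?; ring.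
Qed.

Lemma bform_suml T (I : Type) (s : seq I) (P : pred I) (a : I -> C) (F : I -> 'M[C]_(n + n)) Y :
  in_l_zbar T ->
  bform T (\sum_(i <- s | P i) a i *: F i) Y = \sum_(i <- s | P i) a i * bform T (F i) Y.
Proof.
move=> hT; elim/big_rec2: _ => [|i y U _ <-]; last by rewrite bform_linl.
(* The empty sum: the form vanishes at X = 0, obtained from linearity by cancellation. *)
by apply: (addrI (1 * bform T 0 Y)); rewrite -bform_linl // scaler0 addr0 mul1r addr0.
Qed.

Lemma bform_scalel T a X Y : in_l_zbar T -> bform T (a *: X) Y = a * bform T X Y.
Proof.
by move=> hT; have := @bform_suml T _ [:: tt] xpredT (fun=> a) (fun=> X) Y hT; rewrite !big_seq1.
Qed.

Lemma bform_sumr T (I : Type) (s : seq I) (P : pred I) (a : I -> C) (F : I -> 'M[C]_(n + n)) Y :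
  in_l_zbar T ->
  bform T Y (\sum_(i <- s | P i) a i *: F i) = \sum_(i <- s | P i) a i * bform T Y (F i).
Proof. by move=> hT; rewrite (bformC T Y) bform_suml //; apply: eq_bigr => i _; rewrite (bformC T Y). Qed.

Lemma actT_tens Z A B : actT Z (tens A B) = tens (lie Z A) B + tens A (lie Z B).
Proof.
have E X : mxvec X *m adm Z = mxvec (lie Z X).
  (* [adm] applies [lin_mx] to a bare function; packing [lie Z] as a linear map gives access to
     [mul_vec_lin]. *)
  rewrite /adm; pose f := GRing.isLinear.Build C 'M[C]_(n + n) 'M[C]_(n + n) _ (lie Z)
    (fun a X Y => lieDr Z a X Y).
  pose F : {linear 'M[C]_(n + n) -> 'M[C]_(n + n)} := HB.pack (lie Z) f.
  exact: (mul_vec_lin F X).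
by rewrite /actT /tens mulmxA -trmx_mul -!mulmxA !E.
Qed.

Lemma actT_sum Z (I : Type) (s : seq I) (F : I -> Tens C n) :
  actT Z (\sum_(i <- s) F i) = \sum_(i <- s) actT Z (F i).
Proof. by rewrite /actT mulmx_sumr mulmx_suml big_split. Qed.

Lemma tensDr A X Y : tens A (X + Y) = tens A X + tens A Y.
Proof. by rewrite /tens linearD mulmxDr. Qed.
Lemma tensDl A X Y : tens (X + Y) A = tens X A + tens Y A.
Proof. by rewrite /tens !linearD mulmxDl. Qed.
Lemma tensZl a X A : tens (a *: X) A = a *: tens X A.
Proof. by rewrite /tens !linearZ /= scalemxAl. Qed.
Lemma tensZr a X A : tens X (a *: A) = a *: tens X A.
Proof. by rewrite /tens !linearZ /= scalemxAr. Qed.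
Lemma tens0l A : tens 0 A = 0.
Proof. by rewrite /tens !linear0 mul0mx. Qed.
Lemma tens0r A : tens A 0 = 0.
Proof. by rewrite /tens [mxvec 0]linear0 mulmx0. Qed.

Lemma in_l_zbar0 : in_l_zbar (0 : Tens C n).
Proof. by exists [::]; rewrite big_nil. Qed.

Lemma in_l_zbar_lin a U W : in_l_zbar U -> in_l_zbar W -> in_l_zbar (a *: U + W).
Proof.
case=> s [hs ->] [t [ht ->]]; exists ([seq (a *: p.1, p.2) | p <- s] ++ t); split.
  rewrite all_cat ht andbT all_map; apply: sub_all hs => p /= /andP[h1 ->]; rewrite andbT.
  by rewrite -[_ *: _]addr0 gr_lin // gr0.
by rewrite big_cat big_map scaler_sumr; congr (_ + _); apply: eq_bigr => p _; rewrite tensZl.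
Qed.

Lemma in_l_zbar_sum (I : Type) (s : seq I) (F : I -> Tens C n) :
  (forall i, in_l_zbar (F i)) -> in_l_zbar (\sum_(i <- s) F i).
Proof.
move=> hF; apply: big_ind => [|U W hU hW|i _] //; first exact: in_l_zbar0.
by rewrite -[U]scale1r; apply: in_l_zbar_lin.
Qed.

Lemma in_l_zbar_tens A B : gr 0 A -> gr (-2) B -> in_l_zbar (tens A B).
Proof. by move=> hA hB; exists [:: (A, B)]; rewrite big_seq1 /= hA hB. Qed.

Lemma in_l_zbar_act Z T : gr 0 Z -> in_l_zbar T -> in_l_zbar (actT Z T).
Proof.
move=> hZ [s [/allP hs ->]]; rewrite actT_sum big_seq; apply: big_ind => [|U W hU hW|p /hs /andP[h1 h2]].
- exact: in_l_zbar0.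
- by rewrite -[U]scale1r; apply: in_l_zbar_lin.
rewrite actT_tens -[tens (lie _ _) _]scale1r; apply: in_l_zbar_lin; apply: in_l_zbar_tens => //.
  by rewrite -[0]addr0 gr_lie.
by rewrite -[X in gr X]add0r gr_lie.
Qed.

(** On A (x) B, invariance of kappa moves ad Z off A, and the Jacobi identity distributes it over X,
    Y and B; the terms in [Z, B] cancel against the action on the second leg. *)
Lemma bform_act Z T X Y : gr 0 Z -> in_l_zbar T ->
  bform (actT Z T) X Y = - bform T (lie Z X) Y - bform T X (lie Z Y).
Proof.
move=> hZ [s [hs ->]]; rewrite actT_sum !bform_sum -!sumrN -big_split /=.
apply: eq_big_seq => p /(allP hs) /andP[h1 h2].
rewrite actT_tens -[tens (lie _ _) _]scale1r bform_lin mul1r.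
have h3 : gr (-2) (lie Z p.2) by rewrite -[X in gr X]add0r gr_lie.
rewrite !bform_tens // /quart !kill_inv !(jacobi Z).
have kD (U W : 'M[C]_(n + n)) : kill p.1 (U + W) = kill p.1 U + kill p.1 W.
  by rewrite -[U in LHS]scale1r kill_lin mul1r.
rewrite !lie_addr !kD; do !move: (kill _ _) => ?; ring.
Qed.

End Tensors.

(** * Modules over so(2n) and equivariance of the second-order element *)

Section Modules.
Variables (C : numClosedFieldType) (n : nat).
Implicit Types (A B X Y Z H : 'M[C]_(n + n)) (T U W : Tens C n).
Implicit Types (x y z : 'I_n * 'I_(n + n)).
Local Notation so2n := (@so2n C n).
Local Notation lie := (@lie C n).
Local Notation kill := (@kill C n).
Local Notation rv := (@rv C n).
Variables (V : lmodType C) (rho : 'M[C]_(n + n) -> V -> V).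
Hypothesis hrho : is_gmod rho.

Lemma rho_linr A a u w : so2n A -> rho A (a *: u + w) = a *: rho A u + rho A w.
Proof. by case: hrho => h _ hA; apply: h. Qed.

Lemma rho_linl A B a u : so2n A -> so2n B -> rho (a *: A + B) u = a *: rho A u + rho B u.
Proof. by case: hrho => _ [h _] hA; apply: h. Qed.

Lemma rho_lie A B u : so2n A -> so2n B -> rho (lie A B) u = rho A (rho B u) - rho B (rho A u).
Proof. by case: hrho => _ [_ h] hA; apply: h. Qed.

Lemma rho0l u : rho 0 u = 0.
Proof.
by apply: (addrI (1 *: rho 0 u)); rewrite -rho_linl ?so0 // scaler0 addr0 scale1r addr0.
Qed.

Lemma rho0r A : so2n A -> rho A 0 = 0.
Proof.
by move=> hA; apply: (addrI (1 *: rho A 0)); rewrite -rho_linr // scaler0 addr0 scale1r addr0.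
Qed.

Lemma rhoZl a A u : so2n A -> rho (a *: A) u = a *: rho A u.
Proof. by move=> hA; rewrite -[a *: A]addr0 rho_linl ?so0 // rho0l addr0. Qed.

Lemma rhoZr a A u : so2n A -> rho A (a *: u) = a *: rho A u.
Proof. by move=> hA; rewrite -[a *: u]addr0 rho_linr // rho0r // addr0. Qed.

Lemma rhoDl A B u : so2n A -> so2n B -> rho (A + B) u = rho A u + rho B u.
Proof. by move=> hA hB; rewrite -[A in LHS]scale1r rho_linl // scale1r. Qed.

Lemma rhoDr A u w : so2n A -> rho A (u + w) = rho A u + rho A w.
Proof. by move=> hA; rewrite -[u in LHS]scale1r rho_linr // scale1r. Qed.

Lemma rhoNl A u : so2n A -> rho (- A) u = - rho A u.
Proof. by move=> hA; rewrite -[- A]scaleN1r rhoZl // scaleN1r. Qed.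

Lemma rhoBl A B u : so2n A -> so2n B -> rho (A - B) u = rho A u - rho B u.
Proof. by move=> hA hB; rewrite rhoDl ?soN // rhoNl. Qed.

Lemma rhoBr A u w : so2n A -> rho A (u - w) = rho A u - rho A w.
Proof. by move=> hA; rewrite rhoDr // -[- w]scaleN1r rhoZr // scaleN1r. Qed.

Lemma rho_swap A B u : so2n A -> so2n B -> rho A (rho B u) = rho (lie A B) u + rho B (rho A u).
Proof. by move=> hA hB; rewrite rho_lie // subrK. Qed.

Lemma rho_sumr A (I : Type) (s : seq I) (P : pred I) (F : I -> V) : so2n A ->
  rho A (\sum_(i <- s | P i) F i) = \sum_(i <- s | P i) rho A (F i).
Proof.
by move=> hA; elim/big_rec2: _ => [|i y U _ <-]; rewrite ?rho0r ?rhoDr.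
Qed.

Lemma rho_suml (I : Type) (s : seq I) (P : pred I) (F : I -> 'M[C]_(n + n)) u :
  (forall i, so2n (F i)) ->
  rho (\sum_(i <- s | P i) F i) u = \sum_(i <- s | P i) rho (F i) u.
Proof.
move=> hF; suff: so2n (\sum_(i <- s | P i) F i) /\ rho (\sum_(i <- s | P i) F i) u = \sum_(i <- s | P i) rho (F i) u by case.
elim/big_rec2: _ => [|i y U _ [sU <-]]; first by rewrite so0 rho0l.
by rewrite soD // rhoDl.
Qed.

Definition symact (b : 'M[C]_(n + n) -> 'M[C]_(n + n) -> C) v : V :=
  \sum_(x | @g1idx n x) \sum_(y | @g1idx n y) b (xg C x) (xg C y) *: rho (yg C x) (rho (yg C y) v).

Lemma omega2E T v : omega2_act rho T v = (kap C n)^-1 ^+ 2 *: symact (bform T) v.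
Proof.
rewrite /omega2_act /symact.
pose G (j : 'I_n) q (k : 'I_n) r := (kap C n)^-1 ^+ 2 *:
  (bform T (xg C (j, q)) (xg C (k, r)) *: rho (yg C (j, q)) (rho (yg C (k, r)) v)).
transitivity (\sum_(j < n) \sum_(k < n | in_g1idx j k) \sum_(b : bool)
   \sum_(x | @g1idx n x) G j (sgn_idx k b) x.1 x.2).
  apply: eq_bigr => j _; apply: eq_bigr => k jk; apply: eq_bigr => b _.
  rewrite -(g1_sum (G j (sgn_idx k b))); apply: eq_bigr => j' _; apply: eq_bigr => k' jk'; apply: eq_bigr => b' _.
  have neq (a c : 'I_n) : in_g1idx a c -> a != c.
    by case/andP=> ac; apply: contraTneq => <-; rewrite -ltnNge.
  rewrite -bformE !posvecE !dualnegE ?neq // !rhoZl ?so_rv // rhoZr ?so_rv //.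
  by rewrite /G !scalerA /xg /yg /= -mulrA -expr2 mulrC.
rewrite (g1_sum (fun j q => \sum_(x | @g1idx n x) G j q x.1 x.2)) scaler_sumr; apply: eq_bigr => x _.
by rewrite scaler_sumr; apply: eq_bigr => y _; case: x => ? ?; case: y.
Qed.

Lemma gr1_xg x : g1idx x -> gr 1 (xg C x).
Proof. by case/andP=> h1 /eqP h2; apply: gr_rvE; rewrite degl h1 h2. Qed.

Lemma grm1_yg x : g1idx x -> gr (-1) (yg C x).
Proof. by case/andP=> h1 /eqP h2; apply: gr_rvE; rewrite degl h1 h2. Qed.

Lemma kap_neq0 : (2 <= n)%N -> kap C n != 0.
Proof. by move=> hn; rewrite /kap mulf_neq0 // pnatr_eq0 //; lia. Qed.

(* The expansions of [Z, x_a] and [Z, y_a] in dual bases have opposite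
   transposed coefficient matrices because the Killing form is invariant. *)
Lemma symact_equivariant Z T v : (2 <= n)%N -> gr 0 Z -> in_l_zbar T ->
  rho Z (symact (bform T) v) = symact (bform (actT Z T)) v + symact (bform T) (rho Z v).
Proof.
move=> hn hZ hT; have sZ := gr_so hZ; have k0 := kap_neq0 hn.
have sy x : so2n (yg C x) by apply: so_rv.
pose c x z := (kap C n)^-1 * kill (lie Z (xg C x)) (yg C z).
have lx x : g1idx x -> lie Z (xg C x) = \sum_(z | @g1idx n z) c x z *: xg C z.
  move=> gx; have g : gr 1 (lie Z (xg C x)) by rewrite -[1]add0r gr_lie // gr1_xg.
  rewrite {1}(g1_expand g); apply: eq_bigr => z _; congr (_ *: _).
  by rewrite /c kill_rv ?(gr_so g) // mulKf.
have ly z : g1idx z -> lie Z (yg C z) = \sum_(x | @g1idx n x) - c x z *: yg C x.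
  move=> gz; have g : gr (-1) (lie Z (yg C z)) by rewrite -[X in gr X]add0r gr_lie // grm1_yg.
  rewrite {1}(gm1_expand g); apply: eq_bigr => x _; congr (_ *: _).
  by rewrite /c kill_inv mulrN opprK killC kill_rv ?(gr_so g) // mulKf.
have first : \sum_(x | @g1idx n x) \sum_(y | @g1idx n y)
     bform T (xg C x) (xg C y) *: rho (lie Z (yg C x)) (rho (yg C y) v) =
   \sum_(x | @g1idx n x) \sum_(y | @g1idx n y)
     (- bform T (lie Z (xg C x)) (xg C y)) *: rho (yg C x) (rho (yg C y) v).
  transitivity (\sum_(x | @g1idx n x) \sum_(y | @g1idx n y) \sum_(z | @g1idx n z)
     (- (c x z * bform T (xg C z) (xg C y))) *: rho (yg C x) (rho (yg C y) v)); last first.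
    apply: eq_bigr => x gx; apply: eq_bigr => y _.
    by rewrite lx // bform_suml // -scaler_suml sumrN.
  under [in RHS]eq_bigr do rewrite exchange_big.
  rewrite [in RHS]exchange_big; apply: eq_bigr => z gz /=.
  rewrite [in RHS]exchange_big; apply: eq_bigr => y gy /=.
  rewrite ly // rho_suml => [|x]; last by rewrite so_scale.
  rewrite scaler_sumr; apply: eq_bigr => x gx.
  by rewrite rhoZl // scalerA mulrN mulrC.
have second : \sum_(x | @g1idx n x) \sum_(y | @g1idx n y)
     bform T (xg C x) (xg C y) *: rho (yg C x) (rho (lie Z (yg C y)) v) =
   \sum_(x | @g1idx n x) \sum_(y | @g1idx n y)
     (- bform T (xg C x) (lie Z (xg C y))) *: rho (yg C x) (rho (yg C y) v).
  apply: eq_bigr => x gx.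
  transitivity (\sum_(y | @g1idx n y) \sum_(z | @g1idx n z)
     (- (c y z * bform T (xg C x) (xg C z))) *: rho (yg C x) (rho (yg C y) v)); last first.
    apply: eq_bigr => y gy.
    by rewrite lx // bform_sumr // -scaler_suml sumrN.
  rewrite exchange_big; apply: eq_bigr => z gz /=.
  rewrite ly // rho_suml => [|y]; last by rewrite so_scale.
  rewrite rho_sumr // scaler_sumr; apply: eq_bigr => y gy.
  by rewrite rhoZl // rhoZr // scalerA mulrN mulrC.
have -> : symact (bform (actT Z T)) v =
    \sum_(x | @g1idx n x) \sum_(y | @g1idx n y)
     bform T (xg C x) (xg C y) *: rho (lie Z (yg C x)) (rho (yg C y) v) +
    \sum_(x | @g1idx n x) \sum_(y | @g1idx n y)
     bform T (xg C x) (xg C y) *: rho (yg C x) (rho (lie Z (yg C y)) v).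
  rewrite first second -big_split; apply: eq_bigr => x _ /=.
  rewrite -big_split; apply: eq_bigr => y _ /=.
  by rewrite bform_act // scalerDl.
rewrite /symact rho_sumr // -!big_split; apply: eq_bigr => x _ /=.
rewrite rho_sumr // -!big_split; apply: eq_bigr => y _ /=.
by rewrite rhoZr // rho_swap // (rho_swap _ sZ (sy y)) rhoDr // !scalerDr addrA.
Qed.

End Modules.

(** * The action of n on second-order elements *)

Section Weights.
Variable n : nat.
Implicit Types (p q : 'I_(n + n)).

Lemma wtE p (i : 'I_n) : wt p i = (p == lshift n i)%:Z - (p == rshift n i)%:Z.
Proof.
case: (split_ordP p) => j ->; rewrite ?wtl ?wtr ?ffunE ?eq_lshift ?eq_rshift ?eq_lrshift ?eq_rlshift eq_sym.
  by rewrite subr0.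
by rewrite sub0r.
Qed.

Lemma wt_inj : injective (@wt n).
Proof.
move=> p q; case: (split_ordP p) => j -> /ffunP /(_ j).
  rewrite !wtE eqxx eq_lrshift; case: eqP => [-> //|_]; by case: eqP.
rewrite !wtE eqxx eq_rlshift; case: (q =P rshift n j) => [-> //|_]; by case: eqP.
Qed.

Lemma wt_mid p (i : 'I_n) : mid p -> (i < n - 2)%N -> wt p i = 0.
Proof. by move=> mp li; rewrite wtE mid_lF // mid_rF. Qed.

End Weights.

Lemma card_mid n : (2 <= n)%N -> #|[pred q : 'I_(n + n) | mid q]| = 4.
Proof.
move=> n2; rewrite -sum1_card big_mkcond big_split_ord /=.
have E : \sum_(k < n) (if (n - 2 <= k)%N then 1 else 0)%N = 2.
  rewrite -(big_mkord xpredT (fun k => if (n - 2 <= k)%N then 1 else 0)%N).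
  rewrite (big_cat_nat (n := n - 2)) //=; last by lia.
  rewrite big_nat_cond big1; last by move=> k /andP[/andP[_ lk] _]; rewrite leqNgt lk.
  rewrite big_nat_cond (eq_bigr (fun _ => 1%N)); last by move=> k /andP[/andP[lk _] _]; rewrite lk.
  by rewrite -big_nat_cond sum_nat_const_nat; lia.
rewrite -[4]/(2 + 2)%N; congr (_ + _)%N; rewrite -[RHS]E; apply: eq_bigr => k _;
  by rewrite inE /mid ?degl ?degr ?oppr_eq0 ltnNge; case: (n - 2 <= k)%N.
Qed.

Section Covariance.
Variables (C : numClosedFieldType) (n : nat) (s : C).
Hypothesis n2 : (2 <= n)%N.
Implicit Types (A B X Y Z H : 'M[C]_(n + n)) (T U W : Tens C n).
Implicit Types (p q r : 'I_(n + n)) (i j k : 'I_n).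
Local Notation so2n := (@so2n C n).
Local Notation lie := (@lie C n).
Local Notation rv := (@rv C n).
Variables (V : lmodType C) (rho : 'M[C]_(n + n) -> V -> V) (v0 : V).
Hypotheses (hrho : is_gmod rho) (hv0 : is_Cms_vec s rho v0).
Local Notation f q j := (rho (rv q (lshift n j))).

Lemma v0_gl i j : (i < n - 2)%N -> (j < n - 2)%N ->
  rho (rv (lshift n i) (lshift n j)) v0 = (- s * (i == j)%:R) *: v0.
Proof.
move=> li lj; case: hv0 => hH [hl _]; have [<-|neq] := eqVneq i j.
  rewrite hH ?inh_rv // evw_rv lambda_qE li; congr (_ *: _).
(* Off the diagonal the vector equals its bracket with a Cartan element, so it lies in [l, l]. *)
rewrite mulr0 scale0r -[RHS](hl (rv (lshift n i) (lshift n i)) (rv (lshift n i) (lshift n j))).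
- congr (rho _ _); rewrite lie_rv !cjl eqxx !eq_lrshift eq_lshift eq_sym (negbTE neq).
  by rewrite !scale0r !scale1r !subr0 addr0.
- by apply: gr_rvE; rewrite subrr.
- by apply: gr_rvE; rewrite !degl li lj.
Qed.

Lemma v0_mid p q : mid p -> mid q -> rho (rv p q) v0 = 0.
Proof.
move=> mp mq; case: hv0 => hH [hl _]; have [<-|neq] := eqVneq p q.
  rewrite hH ?inh_rv // /evw big1 ?mulr0 ?scale0r // => i _; rewrite lambda_qE rvE.
  have [li|_] := ltnP i (n - 2); last by rewrite mul0r.
  have F : (lshift n i == p) = false by rewrite eq_sym mid_lF.
  by rewrite F eq_sym cj_eq cjl mid_rF // !mul0r subr0 mulr0.
rewrite -[RHS](hl (rv p p) (rv p q)).
- congr (rho _ _); rewrite lie_rv eqxx eq_sym (negbTE neq) (eq_sym p (cj p)) cj_neq rv_cj0.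
  by rewrite scaler0 !scale0r !scale1r !subr0 addr0.
- by apply: gr_rvE; rewrite subrr.
- by apply: gr_rvE; rewrite (eqP mp) (eqP mq).
Qed.

Lemma v0_char Z : gr 0 Z -> exists c, rho Z v0 = c *: v0.
Proof.
move=> hZ; suff: so2n Z /\ exists c, rho Z v0 = c *: v0 by case.
apply: (so_ind (P := fun Z => so2n Z /\ exists c, rho Z v0 = c *: v0) (gr_so hZ)).
- by rewrite so0 (rho0l hrho); split=> //; exists 0; rewrite scale0r.
- move=> a A B [sA [c hA]] [sB [d hB]]; rewrite so_lin //; split=> //.
  by exists (a * c + d); rewrite (rho_linl hrho) // hA hB scalerA scalerDl.
move=> p q nz; split; first exact: so_rv.
move: (gr_entry hZ nz) => {nz}; case: (degP p) => [j lj|j lj|{}p mp]; case: (degP q) => [k lk|k lk|{}q mq] //= _.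
- by eexists; apply: v0_gl.
- by rewrite -!cjl rv_cj (rhoNl hrho) ?so_rv // v0_gl // -scaleNr; eexists.
- by exists 0; rewrite v0_mid // scale0r.
Qed.

Lemma v0_n X : gr 1 X -> rho X v0 = 0.
Proof.
by move=> hX; case: hv0 => _ [_]; apply; exists X, 0; rewrite gr0 addr0.
Qed.

Variables (j : 'I_n) (p : 'I_(n + n)).
Hypotheses (lj : (j < n - 2)%N) (mp : mid p).
Let X := rv (lshift n j) p.

Lemma lie_x_f q k : (k < n - 2)%N -> mid q ->
  lie X (rv q (lshift n k)) = (p == q)%:R *: rv (lshift n j) (lshift n k) - (k == j)%:R *: rv q p.
Proof.
move=> lk mq; rewrite lie_rv cjl eq_lshift mid_rF // (eq_sym _ (cj q)) cj_eq cjl mid_rF //.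
by rewrite !scale0r subr0 addr0.
Qed.

Lemma lie_gl_f q k i : (k < n - 2)%N -> mid q ->
  lie (rv (lshift n j) (lshift n k)) (rv q (lshift n i)) = - ((i == j)%:R *: rv q (lshift n k)).
Proof.
move=> lk mq; rewrite lie_rv cjl eq_lshift eq_lrshift (eq_sym _ (cj q)) cj_eq cjl mid_rF //.
by rewrite (eq_sym _ q) mid_lF // !scale0r subr0 addr0 sub0r.
Qed.

Lemma lie_mid_f a b q i : mid a -> mid b -> (i < n - 2)%N ->
  lie (rv a b) (rv q (lshift n i)) =
  (b == q)%:R *: rv a (lshift n i) - (a == cj q)%:R *: rv (cj b) (lshift n i).
Proof.
move=> ma mb li; rewrite lie_rv cjl (eq_sym _ a) mid_lF // mid_rF // !scale0r !subr0.
by rewrite -[rshift n i]cjl -{2}[b]cjK rv_cj scalerN.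
Qed.

Lemma x_ff q k r i : (k < n - 2)%N -> mid q -> (i < n - 2)%N -> mid r ->
  rho X (f q k (f r i v0)) =
  - ((p == q)%:R * (i == j)%:R) *: f r k v0 - (s * (p == q)%:R * (j == k)%:R) *: f r i v0
  - ((k == j)%:R * (p == r)%:R) *: f q i v0 + ((k == j)%:R * (q == cj r)%:R) *: f (cj p) i v0
  - (s * (p == r)%:R * (j == i)%:R) *: f q k v0.
Proof.
move=> lk mq li mr; have sX : so2n X by apply: so_rv.
have X1 : gr 1 X by apply: gr_rvE; rewrite degl lj (eqP mp).
have sr a b : so2n (rv a b) by apply: so_rv.
have sZ a b c : so2n (c *: rv a b) by apply: so_scale.
have xf : rho X (f r i v0) = (- s * (p == r)%:R * (j == i)%:R) *: v0.
  rewrite (rho_swap hrho) // lie_x_f // (rhoBl hrho) // !(rhoZl hrho) //.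
  by rewrite v0_gl // v0_mid // v0_n // (rho0r hrho) // scaler0 subr0 addr0 scalerA; congr (_ *: _); ring.
rewrite (rho_swap hrho) // xf lie_x_f // (rhoBl hrho) // !(rhoZl hrho) // (rhoZr hrho) //.
rewrite !(rho_swap hrho _ (sr _ _) (sr r _)) v0_gl // v0_mid // (rho0r hrho) // (rhoZr hrho) //.
rewrite lie_gl_f // lie_mid_f // (rhoNl hrho) // (rhoBl hrho) // !(rhoZl hrho) //.
rewrite addr0 !scalerDr !scalerN !scalerA opprD opprK !addrA -!scaleNr.
congr (_ + _ + _ + _ + _); congr (_ *: _); ring.
Qed.

(** In [x_ff] with r = cj q, one term is independent of q and is counted dim C^4 = 4 times; the
    terms selecting q = p and q = cj p each cost 1 + s. The total is 4 - 2(1 + s). *)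
Lemma x_casimir i : (i < n - 2)%N ->
  rho X (\sum_(q | mid q) f q i (f (cj q) i v0)) =
  ((j == i)%:R * (2%:R - 2%:R * s)) *: f (cj p) i v0.
Proof.
move=> li; rewrite (rho_sumr hrho) ?so_rv //.
rewrite (eq_bigr (fun q => (p == q)%:R *: (- ((j == i)%:R * (1 + s)) *: f (cj q) i v0)
  + (cj p == q)%:R *: (- ((j == i)%:R * (1 + s)) *: f q i v0) + (j == i)%:R *: f (cj p) i v0)); last first.
  move=> q mq; rewrite x_ff ?mid_cj // cjK eqxx -cj_eq (eq_sym i j) mulr1.
  have E (e d : C) (u : V) : e *: (- (d * (1 + s)) *: u) = - (e * d) *: u - (s * e * d) *: u.
    by rewrite scalerA -scaleNr -scalerDl; congr (_ *: _); ring.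
  by rewrite !E addrA [RHS]addrAC [(j == i)%:R * _]mulrC -scaleNr.
rewrite !big_split /=.
have E (r : 'I_(n + n)) (F : 'I_(n + n) -> V) : mid r -> \sum_(q | mid q) (r == q)%:R *: F q = F r.
  move=> mr; rewrite (bigD1 r) //= eqxx scale1r big1 ?addr0 // => q /andP[_ neq].
  by rewrite eq_sym (negbTE neq) scale0r.
rewrite !E ?mid_cj // sumr_const (card_mid n2) -scaler_nat scalerA -!scalerDl.
by congr (_ *: _); ring.
Qed.

(** For each surviving vector one of the two orderings contributes the character and the other a
    bracket in l, with opposite signs. The condition [a != cj b] removes the contraction by the
    quadratic form. *)
Lemma x_wedge a b i k : (i < n - 2)%N -> (k < n - 2)%N -> i != k ->
  mid a -> mid b -> a != b -> a != cj b ->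
  rho X (f a i (f b k v0) - f b i (f a k v0)) =
  (1 - s) *: (((j == i)%:R * (p == a)%:R) *: f b k v0 - ((j == k)%:R * (p == a)%:R) *: f b i v0
    - ((j == i)%:R * (p == b)%:R) *: f a k v0 + ((j == k)%:R * (p == b)%:R) *: f a i v0).
Proof.
move=> li lk ik ma mb ab acb; rewrite (rhoBr hrho) ?so_rv // !x_ff // (negbTE acb).
have -> : (b == cj a) = false by rewrite -cj_eq eq_sym (negbTE acb).
rewrite !mulr0 !scale0r !addr0 (eq_sym k j) (eq_sym i j).
rewrite !opprD !opprK !scalerDr !scalerN !scalerA -!scaleNr !addrA !opprK.
move: (f a i v0) (f b i v0) (f a k v0) (f b k v0) (j == i)%:R (j == k)%:R (p == a)%:R (p == b)%:R
  => u1 u2 u3 u4 d1 d2 e1 e2.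
(* Each pair joins the bracket term and the character term on the same vector. *)
rewrite [LHS](ACl ((2*7)*(1*8)*(3*6)*(4*5)))%AC /= -!scalerDl.
by congr (_ *: _ + _ *: _ + _ *: _ + _ *: _); ring.
Qed.

End Covariance.

Section Annihilation.
Variables (C : numClosedFieldType) (n : nat).
Hypothesis n2 : (2 <= n)%N.
Local Notation so2n := (@so2n C n).
Local Notation rv := (@rv C n).
Variables (V : lmodType C) (rho : 'M[C]_(n + n) -> V -> V).
Hypothesis hrho : is_gmod rho.

Lemma in_n_rv (j : 'I_n) p : (j < n - 2)%N -> mid p -> in_n (rv (lshift n j) p).
Proof.
move=> lj /eqP mp; exists (rv (lshift n j) p), 0; rewrite gr0 addr0; split=> //.
by apply: gr_rvE; rewrite degl lj mp.
Qed.

(* g(1) generates n. *)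
Lemma in_n_kill w :
  (forall (j : 'I_n) p, (j < n - 2)%N -> mid p -> rho (rv (lshift n j) p) w = 0) ->
  forall X, in_n X -> rho X w = 0.
Proof.
move=> kw X [X1 [X2 [g1 [g2 ->]]]]; rewrite (rhoDl hrho) ?(gr_so g1) ?(gr_so g2) //.
have -> : rho X1 w = 0.
  rewrite (g1_expand g1) (rho_suml hrho) => [|x]; last by rewrite so_scale ?so_rv.
  by rewrite big1 // => x /andP[lj mp]; rewrite (rhoZl hrho) ?so_rv // kw // scaler0.
rewrite add0r; suff: so2n X2 /\ rho X2 w = 0 by case.
apply: (so_ind (P := fun X => so2n X /\ rho X w = 0) (gr_so g2)).
- by rewrite so0 (rho0l hrho).
- by move=> a A B [sA hA] [sB hB]; rewrite so_lin // (rho_linl hrho) // hA hB scaler0 addr0.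
move=> p q nz; split; first exact: so_rv.
move: (gr_entry g2 nz) => {nz}; case: (degP p) => [j lj|j lj|{}p mp]; case: (degP q) => [k lk|k lk|{}q mq] //= _.
(* Any [mid] index r will do to write a root vector of g(2) as a bracket of two of g(1); the last
   coordinate supplies one. *)
have lt_n1 : (n.-1 < n)%N by lia.
have [r mr] : exists r : 'I_(n + n), mid r.
  by exists (lshift n (Ordinal lt_n1)); rewrite /mid degl /=; case: ltnP => //; lia.
have mr' : mid (cj r) by rewrite mid_cj.
have -> : rv (lshift n j) (rshift n k) = - lie (rv (lshift n j) r) (rv (lshift n k) (cj r)).
  rewrite lie_rv cjK !cjl eqxx !mid_lF // eq_lrshift !scale0r scale1r subr0 addr0 sub0r.
  by rewrite opprK.
rewrite (rhoNl hrho) ?so_lie ?so_rv // (rho_lie hrho) ?so_rv // !kw // !(rho0r hrho) ?so_rv //.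
by rewrite subrr oppr0.
Qed.

End Annihilation.

(** * Weight and lowering constraints on lowest weight tensors *)

Section LowestWeight.
Variables (C : numClosedFieldType) (n : nat).
Implicit Types (T : Tens C n) (nu : weight n) (p q : 'I_(n + n)) (x y : 'I_n * 'I_(n + n)).
Local Notation lie := (@lie C n).
Local Notation rv := (@rv C n).

(** Equivariance under the Cartan element [rv i i] compares the i-th coordinates of the two weights,
    provided that the value of the form can be cancelled. *)
Lemma lowW_weight nu T x y : lowW nu T -> bform T (xg C x) (xg C y) != 0 ->
  wt (lshift n x.1) - wt x.2 + (wt (lshift n y.1) - wt y.2) = nu.
Proof.
case=> hT [hH _] nz; apply/ffunP => i.
have hi := inh_rv C (lshift n i).
have [_ hx] := rootsp_rv C (lshift n x.1) x.2; have [_ hy] := rootsp_rv C (lshift n y.1) y.2.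
have := bform_act (xg C x) (xg C y) (inh_gr0 hi) hT; rewrite hH //.
rewrite -[_ *: T]addr0 bform_lin bform0 addr0 hx // hy // bform_scalel // (bformC T (xg C x) (_ *: _)).
rewrite bform_scalel // -[rv _ y.2]/(xg C y) (bformC T (xg C y)) -!mulNr -mulrDl => /(mulIf nz).
by rewrite -opprD -evwD -evwN !evw_rv => /intr_inj; rewrite !ffunE => /oppr_inj ->.
Qed.

Lemma lowW_neg nu T p q : lowW nu T -> isPosRoot (wt q - wt p) -> deg p = deg q ->
  actT (rv p q) T = 0.
Proof.
case=> _ [_ hn] pos dpq; apply: (hn _ _ pos); last by apply: gr_rvE; rewrite dpq subrr.
by rewrite opprB; apply: rootsp_rv.
Qed.

Lemma pos_lr (i j : 'I_n) : (i < j)%N -> isPosRoot (wt (lshift n i) - wt (lshift n j)).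
Proof.
move=> ij; apply/existsP; exists i; apply/existsP; exists j.
by rewrite ij !wtl eqxx orbT.
Qed.

End LowestWeight.

(** * Lowest weight forms *)

Section HighWeights.
Variables (C : numClosedFieldType) (n : nat) (hn : (5 <= n)%N).
Local Notation rv := (@rv C n).
Implicit Types (T : Tens C n) (p q : 'I_(n + n)) (x y : 'I_n * 'I_(n + n)).

Definition o1 : 'I_n := Ordinal (ltn_trans (isT : (0 < 4)%N) hn).
Definition o2 : 'I_n := Ordinal (ltn_trans (isT : (1 < 4)%N) hn).
Lemma oa_proof : (n - 2 < n)%N. Proof. by lia. Qed.
Lemma ob_proof : (n - 1 < n)%N. Proof. by lia. Qed.
Definition oa : 'I_n := Ordinal oa_proof.
Definition ob : 'I_n := Ordinal ob_proof.

Lemma o1_lt : (o1 < n - 2)%N. Proof. by rewrite /=; lia. Qed.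
Lemma o2_lt : (o2 < n - 2)%N. Proof. by rewrite /=; lia. Qed.

Lemma oab_ge (k : 'I_n) : (n - 2 <= k)%N -> k = oa \/ k = ob.
Proof.
move=> lk; have [e|neq] := eqVneq (k : nat) (n - 2)%N; [left|right]; apply: val_inj => //=.
by move: (ltn_ord k) => lt_k; move/eqP: neq => /= neq; lia.
Qed.

Lemma mid_oa : mid (lshift n oa). Proof. by rewrite /mid degl /= ltnn. Qed.
Lemma mid_ob : mid (lshift n ob).
Proof. by rewrite /mid degl /=; case: ltnP => //; lia. Qed.

Lemma midE q : mid q -> exists2 k, k = oa \/ k = ob & q = lshift n k \/ q = rshift n k.
Proof.
case: (split_ordP q) => k ->; rewrite /mid ?degl ?degr ?oppr_eq0; case: ltnP => // lk _;
by exists k; [exact: oab_ge|auto].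
Qed.

Definition nu0 : weight n := wt (lshift n o1) + wt (lshift n o1).
(** Written through the indices a = [rshift n oa] and b rather than as eps_(n-1) +- eps_n, because
    [xg (j, q)] has weight eps_j - wt q: the support of the form then shows a and b themselves. *)
Definition nu1 (b : 'I_(n + n)) : weight n :=
  wt (lshift n o1) + wt (lshift n o2) - wt (rshift n oa) - wt b.

Section Type0.
Variables (T : Tens C n) (hT : lowW nu0 T).

Lemma nu0_support x y : g1idx x -> g1idx y -> bform T (xg C x) (xg C y) != 0 ->
  x.1 = o1 /\ y = (o1, cj x.2).
Proof.
case/andP=> lx mx /andP[ly my] nz; have e := lowW_weight hT nz.
(* The coordinate of eps_1 in nu is 2, so both first indices are 1; what remains says that the two
   [mid] weights cancel. *)
have := congr1 (fun w : weight n => w o1) e; rewrite !ffunE (wt_mid mx o1_lt) (wt_mid my o1_lt).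
rewrite !wtE !eq_lshift !eq_lrshift eqxx; have [ex|_] := eqVneq x.1 o1; have [ey|_] := eqVneq y.1 o1 => //= _; split=> //.
move: e; rewrite ex ey /nu0 addrACA -[RHS]addr0 => /addrI; rewrite -opprD => /eqP; rewrite oppr_eq0 addr_eq0.
move=> /eqP e; rewrite [LHS]surjective_pairing ey; congr (_, _); apply: wt_inj.
by rewrite wt_cj e opprK.
Qed.

(* One lowering operator of so(4) exchanges the two hyperbolic pairs. *)
Lemma nu0_const q : mid q -> bform T (xg C (o1, q)) (xg C (o1, cj q)) =
  bform T (xg C (o1, lshift n oa)) (xg C (o1, rshift n oa)).
Proof.
have hz : in_l_zbar T by case: hT.
have ab : (oa < ob)%N by rewrite /=; lia.
have dab : deg (lshift n ob) = deg (lshift n oa) by rewrite (eqP mid_oa) (eqP mid_ob).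
have gz : gr 0 (rv (lshift n ob) (lshift n oa)) by apply: gr_rvE; rewrite dab subrr.
have ab' : (oa == ob) = false by rewrite -val_eqE /= ltn_eqF.
have E : bform T (xg C (o1, lshift n ob)) (xg C (o1, rshift n ob)) =
         bform T (xg C (o1, lshift n oa)) (xg C (o1, rshift n oa)).
  have neq : (lshift n oa == lshift n o1) = false by rewrite eq_lshift -val_eqE /=; lia.
  have lx : lie (rv (lshift n ob) (lshift n oa)) (xg C (o1, lshift n ob)) = -1 *: xg C (o1, lshift n oa).
    rewrite /xg /= lie_rv !cjl eqxx neq !eq_lrshift !scale0r scale1r !subr0 addr0 sub0r.
    by rewrite scaleN1r.
  have lx' : lie (rv (lshift n ob) (lshift n oa)) (xg C (o1, rshift n oa)) = xg C (o1, rshift n ob).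
    rewrite /xg /= lie_rv !cjl !cjr eqxx neq !eq_lrshift eq_rlshift !scale0r scale1r !subr0 addr0 sub0r.
    by rewrite -rv_cj cjl cjr.
  have := bform_act (xg C (o1, lshift n ob)) (xg C (o1, rshift n oa)) gz hz.
  rewrite (lowW_neg hT (pos_lr ab) dab) bform0 lx lx' (bform_scalel _ _ _ hz).
  move: (bform T _ _) (bform T _ _) => u w; rewrite mulN1r opprK => /esym/eqP.
  by rewrite subr_eq0 => /eqP.
case/midE=> k [] -> [] ->.
- rewrite cjl; exact: erefl.
- rewrite cjr; exact: bformC.
- rewrite cjl; exact: E.
- rewrite cjr bformC; exact: E.
Qed.

Variables (V : lmodType C) (rho : 'M[C]_(n + n) -> V -> V).

Lemma symact_nu0 v : symact rho (bform T) v =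
  bform T (xg C (o1, lshift n oa)) (xg C (o1, rshift n oa)) *:
  \sum_(q | mid q) rho (rv q (lshift n o1)) (rho (rv (cj q) (lshift n o1)) v).
Proof.
pose G (i : 'I_n) q := \sum_(y | @g1idx n y)
  bform T (xg C (i, q)) (xg C y) *: rho (yg C (i, q)) (rho (yg C y) v).
rewrite /symact (eq_bigr (fun x => G x.1 x.2)); last by case.
rewrite -(pair_big_dep (fun j : 'I_n => (j < n - 2)%N) (fun _ q => mid q) G) /=.
rewrite (bigD1 o1) ?o1_lt //= [X in _ + X]big1 ?addr0; last first.
  move=> j /andP[lj neq]; rewrite big1 // => q mq; rewrite /G big1 // => y gy.
  have [->|nz] := eqVneq (bform T (xg C (j, q)) (xg C y)) 0; first by rewrite scale0r.
  have gx : g1idx (j, q) by rewrite /g1idx /= lj.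
  by have [/= e _] := nu0_support gx gy nz; rewrite e eqxx in neq.
rewrite scaler_sumr; apply: eq_bigr => q mq; rewrite /G.
have gx : g1idx (o1, q) by rewrite /g1idx /= o1_lt.
rewrite (bigD1 (o1, cj q)) /=; last by rewrite /g1idx /= o1_lt mid_cj.
rewrite nu0_const // big1 ?addr0 // => y /andP[gy neq].
have [->|nz] := eqVneq (bform T (xg C (o1, q)) (xg C y)) 0; first by rewrite scale0r.
by have [/= _ e] := nu0_support gx gy nz; rewrite e eqxx in neq.
Qed.

End Type0.

Section Type1.
Variables (b : 'I_(n + n)) (hb : b = lshift n ob \/ b = rshift n ob).
Variables (T : Tens C n) (hT : lowW (nu1 b) T).
Local Notation a := (rshift n oa).

Lemma ab_facts : [/\ mid a, mid b, a != b & a != cj b].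
Proof.
have ab' : (oa == ob) = false by rewrite -val_eqE /=; lia.
have ma : mid a by rewrite -cjl mid_cj mid_oa.
by split=> //; case: hb => ->; rewrite ?cjl ?cjr ?eq_rlshift ?eq_rshift ?ab' // -?cjl ?mid_cj mid_ob.
Qed.

Lemma nu1_support x y : g1idx x -> g1idx y -> bform T (xg C x) (xg C y) != 0 ->
  ((x == (o1, a)) && (y == (o2, b))) || ((x == (o1, b)) && (y == (o2, a))) ||
  ((x == (o2, a)) && (y == (o1, b))) || ((x == (o2, b)) && (y == (o1, a))).
Proof.
have [ma mb ab acb] := ab_facts.
case: x y => [i p] [j q] /andP[/= lx mx] /andP[/= ly my] nz; have /= e := lowW_weight hT nz.
have o12 : (o1 == o2) = false by [].
have o21 : (o2 == o1) = false by [].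
have e1 := congr1 (fun w : weight n => w o1) e; have e2 := congr1 (fun w : weight n => w o2) e.
move: e1 e2; rewrite !ffunE !(wt_mid mx) ?(wt_mid my) ?(wt_mid ma) ?(wt_mid mb) ?o1_lt ?o2_lt //.
rewrite !wtE !eq_lshift !eq_lrshift !eqxx o12 o21 !xpair_eqE.
(* At eps_(n-1) the right side is -1 and only a has that coordinate, so p or q is a and the other
   one follows by cancellation. *)
have key : wt p + wt q = wt a + wt b -> (p == a) && (q == b) || (p == b) && (q == a).
  move=> epq; have := congr1 (fun w : weight n => w oa) epq; rewrite !ffunE !wtE eqxx eq_rlshift.
  have -> : (b == lshift n oa) = false.
    by case: hb => ->; rewrite ?eq_lshift ?eq_rlshift // -val_eqE /=; lia.
  have -> : (b == a) = false by rewrite eq_sym (negbTE ab).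
  case: (eqVneq p a) epq => [->|npa] epq.
    by move/addrI: epq => /wt_inj ->; rewrite !eqxx.
  case: (eqVneq q a) epq => [->|nqa] epq.
    by move: epq; rewrite addrC => /addrI /wt_inj ->; rewrite !eqxx orbT.
  by case: (p == _); case: (q == _).
have [ei|_] := eqVneq i o1; have [ej|_] := eqVneq j o1; rewrite ?ei ?ej ?o12 ?o21 //= => _.
  have [ej2|_] //= := eqVneq j o2 => _; move: e.
  rewrite ei ej2 addrACA -opprD /nu1 -[RHS]addrA -[in RHS]opprD => /addrI/oppr_inj/key.
  by rewrite !orbF.
have [ei2|_] //= := eqVneq i o2 => _; move: e.
rewrite ei2 ej addrACA -opprD /nu1 -[RHS]addrA -[in RHS]opprD [wt (lshift n o2) + _]addrC.
by move=> /addrI/oppr_inj/key.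
Qed.

(** The lowering operator of gl(n-2) from eps_1 to eps_2 kills T; its action is evaluated at the
    pair (1, a), (1, b). *)
Lemma nu1_anti : bform T (xg C (o1, b)) (xg C (o2, a)) = - bform T (xg C (o1, a)) (xg C (o2, b)).
Proof.
have hz : in_l_zbar T by case: hT.
have dab : deg (lshift n o2) = deg (lshift n o1) by rewrite !degl o1_lt o2_lt.
have gz : gr 0 (rv (lshift n o2) (lshift n o1)) by apply: gr_rvE; rewrite dab subrr.
have [ma mb _ _] := ab_facts.
have E q : mid q -> lie (rv (lshift n o2) (lshift n o1)) (xg C (o1, q)) = xg C (o2, q).
  move=> mq; rewrite /xg /fst /snd lie_rv eqxx cjl eq_lrshift (eq_sym _ (cj q)).
  by rewrite !mid_lF ?mid_cj ?o1_lt ?o2_lt // !scale0r scale1r !subr0 addr0.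
have := bform_act (xg C (o1, a)) (xg C (o1, b)) gz hz.
rewrite (lowW_neg hT (pos_lr (isT : (o1 < o2)%N)) dab) bform0 !E // (bformC T (xg C (o2, a))).
move: (bform T _ _) (bform T _ _) => u w /esym/eqP.
by rewrite subr_eq0 eqr_oppLR => /eqP.
Qed.

Variables (V : lmodType C) (rho : 'M[C]_(n + n) -> V -> V).
Hypothesis hrho : is_gmod rho.

(** Four ordered pairs support the form. They merge two by two, because the form is symmetric and
    the root vectors concerned commute, which gives the factor 2; [nu1_anti] supplies the sign. *)
Lemma symact_nu1 v : symact rho (bform T) v =
  (2%:R * bform T (xg C (o1, a)) (xg C (o2, b))) *:
  (rho (rv a (lshift n o1)) (rho (rv b (lshift n o2)) v)
   - rho (rv b (lshift n o1)) (rho (rv a (lshift n o2)) v)).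
Proof.
have [ma mb ab acb] := ab_facts; have ba := ab; rewrite eq_sym in ba.
have o12 : (o1 == o2) = false by [].
have o21 : (o2 == o1) = false by [].
pose F x y := bform T (xg C x) (xg C y) *: rho (yg C x) (rho (yg C y) v).
have F0 x y : g1idx x -> g1idx y -> ~~ (((x == (o1, a)) && (y == (o2, b))) || ((x == (o1, b)) && (y == (o2, a))) ||
  ((x == (o2, a)) && (y == (o1, b))) || ((x == (o2, b)) && (y == (o1, a)))) -> F x y = 0.
  move=> gx gy h; rewrite /F; have [->|nz] := eqVneq (bform T (xg C x) (xg C y)) 0; first by rewrite scale0r.
  by rewrite (nu1_support gx gy nz) in h.
have g (i : 'I_n) q : (i < n - 2)%N -> mid q -> g1idx (i, q) by move=> li mq; apply/andP.
have g1a := g _ _ o1_lt ma; have g1b := g _ _ o1_lt mb.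
have g2a := g _ _ o2_lt ma; have g2b := g _ _ o2_lt mb.
have S x y0 : g1idx x -> g1idx y0 ->
   (forall y, (((x == (o1, a)) && (y == (o2, b))) || ((x == (o1, b)) && (y == (o2, a))) ||
  ((x == (o2, a)) && (y == (o1, b))) || ((x == (o2, b)) && (y == (o1, a)))) = (y == y0)) ->
   \sum_(y | @g1idx n y) F x y = F x y0.
  move=> gx gy h; rewrite (bigD1 y0) //= big1 ?addr0 // => y /andP[gy' neq].
  by apply: F0 => //; rewrite h.
have nab := negbTE ab; have nba := negbTE ba.
have four (G : 'I_n * 'I_(n + n) -> V) :
    (forall x, g1idx x -> x != (o1, a) -> x != (o2, b) -> x != (o1, b) -> x != (o2, a) -> G x = 0) ->
    \sum_(x | @g1idx n x) G x = G (o1, a) + (G (o2, b) + (G (o1, b) + G (o2, a))).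
  move=> G0; rewrite (bigD1 (o1, a)) // (bigD1 (o2, b)) ?g2b // (bigD1 (o1, b)); last first.
    by rewrite g1b !xpair_eqE o12 nba andbF.
  rewrite (bigD1 (o2, a)); last by rewrite g2a !xpair_eqE o21 nab andbF.
  rewrite big1 /= ?addr0 //.
  by move=> x /andP[/andP[/andP[/andP[gx n1] n2] n3] n4]; apply: G0.
rewrite /symact four; last first.
  move=> x gx /negbTE n1 /negbTE n2 /negbTE n3 /negbTE n4.
  by apply: big1 => y gy; apply: F0 => //; rewrite n1 n2 n3 n4.
rewrite (S (o1, a) (o2, b)) // => [|y]; last by rewrite !xpair_eqE !eqxx o12 nab !andbF !orbF.
rewrite (S (o2, b) (o1, a)) // => [|y]; last by rewrite !xpair_eqE !eqxx o21 nba !andbF.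
rewrite (S (o1, b) (o2, a)) // => [|y]; last by rewrite !xpair_eqE !eqxx o12 nba !andbF !orbF.
rewrite (S (o2, a) (o1, b)) // => [|y]; last by rewrite !xpair_eqE !eqxx o21 nab !andbF !orbF.
rewrite /F (bformC T (xg C (o2, b))) (bformC T (xg C (o2, a))) nu1_anti.
have sr p q : so2n (rv p q) by apply: so_rv.
have comm p q : mid p -> mid q -> p != cj q -> forall u,
    rho (yg C (o2, q)) (rho (yg C (o1, p)) u) = rho (yg C (o1, p)) (rho (yg C (o2, q)) u).
  move=> mp mq npq u; rewrite /yg /= (rho_swap hrho) // lie_rv !cjl eq_lrshift.
  have -> : (lshift n o2 == p) = false by rewrite eq_sym mid_lF ?o2_lt.
  have -> : (lshift n o1 == q) = false by rewrite eq_sym mid_lF ?o1_lt.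
  have -> : (q == cj p) = false by rewrite -cj_eq eq_sym (negbTE npq).
  by rewrite !scale0r !subr0 addr0 (rho0l hrho) add0r.
have bca : b != cj a by rewrite -cj_eq eq_sym.
rewrite (comm a b) // (comm b a) //.
rewrite /yg /fst /snd; move: (bform T _ _) => c.
move: (rho _ (rho _ v)) (rho _ (rho _ v)) => u w.
by rewrite !scaleNr scalerBr mulr_natl mulr2n !scalerDl opprD !addrA.
Qed.

End Type1.
End HighWeights.

(** * Lowest weight tensors *)

Section Reduction.
Variables (C : numClosedFieldType) (n : nat) (s : C).
Hypothesis n2 : (2 <= n)%N.
Local Notation so2n := (@so2n C n).
Local Notation lie := (@lie C n).

Lemma in_n_so (X : 'M[C]_(n + n)) : in_n X -> so2n X.
Proof. by case=> X1 [X2 [g1 [g2 ->]]]; rewrite soD ?(gr_so g1) ?(gr_so g2). Qed.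

Lemma in_n_lie (X Z : 'M[C]_(n + n)) : in_n X -> gr 0 Z -> in_n (lie X Z).
Proof.
case=> X1 [X2 [g1 [g2 ->]]] gZ; exists (lie X1 Z), (lie X2 Z).
rewrite -[1]addr0 -[2]addr0 !gr_lie //; split=> //; split=> //.
by rewrite -[X1]scale1r lieDl !scale1r.
Qed.

Lemma symact_lin (V : lmodType C) (rho : 'M[C]_(n + n) -> V -> V) a (U W : Tens C n) v :
  symact rho (bform (a *: U + W)) v = a *: symact rho (bform U) v + symact rho (bform W) v.
Proof.
rewrite /symact scaler_sumr -big_split; apply: eq_bigr => x _ /=.
rewrite scaler_sumr -big_split; apply: eq_bigr => y _ /=.
by rewrite bform_lin scalerDl scalerA.
Qed.

Lemma symact_scale (V : lmodType C) (rho : 'M[C]_(n + n) -> V -> V) (T : Tens C n) c v :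
  is_gmod rho -> symact rho (bform T) (c *: v) = c *: symact rho (bform T) v.
Proof.
move=> hrho; rewrite /symact scaler_sumr; apply: eq_bigr => x _ /=.
rewrite scaler_sumr; apply: eq_bigr => y _ /=.
by rewrite !(rhoZr hrho) ?so_rv // !scalerA mulrC.
Qed.

Lemma conf_inv_low (nu : weight n) :
  (forall T, lowW nu T -> forall (V : lmodType C) (rho : 'M[C]_(n + n) -> V -> V) v0,
     is_gmod rho -> is_Cms_vec s rho v0 ->
     forall X, in_n X -> rho X (symact rho (bform T) v0) = 0) ->
  conf_inv s nu.
Proof.
move=> low Y hY X hX V rho v0 hrho hv0.
rewrite (omega2E hrho) (rhoZr hrho) ?in_n_so //.
(* Membership in l (x) z(nbar) is carried along since equivariance of the form is available there.
   Stability under l then rests on [n, l] being in n and on l acting on v0 by scalars. *)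
pose P (T : Tens C n) := in_l_zbar T /\
  forall X, in_n X -> rho X (symact rho (bform T) v0) = 0.
have [_ h] : P Y; last by rewrite h // scaler0.
apply: hY => [|a U W [zU kU] [zW kW]|Z U gZ [zU kU]|U lU].
- split=> [|X' hX']; first exact: in_l_zbar0.
  rewrite /symact big1 ?(rho0r hrho) ?in_n_so // => x _; rewrite big1 // => y _.
  by rewrite bform0 scale0r.
- split=> [|X' hX']; first exact: in_l_zbar_lin.
  by rewrite symact_lin (rho_linr hrho) ?in_n_so // kU // kW // scaler0 addr0.
- split=> [|X' hX']; first exact: in_l_zbar_act.
  have := symact_equivariant hrho v0 n2 gZ zU; have [c ->] := v0_char hrho hv0 gZ.
  rewrite symact_scale // => /(canLR (addrK _)) <-.
  rewrite (rhoBr hrho) ?in_n_so // (rhoZr hrho) ?in_n_so // (kU X') // scaler0 subr0.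
  rewrite (rho_swap hrho _ (in_n_so hX') (gr_so gZ)) (kU X') // (rho0r hrho) ?(gr_so gZ) // addr0.
  by apply: kU; apply: in_n_lie.
- by split; [case: lU|apply: low].
Qed.

End Reduction.

(** * Positive roots of the Levi factor *)

Section PositiveRoots.
Variables (n : nat) (hn : (5 <= n)%N).
Implicit Types p q : 'I_(n + n).

(** The leading coordinate is enough to tell raising from lowering root vectors in l. *)
Lemma posroot_lead (a : weight n) : isPosRoot a ->
  exists2 i, a i = 1 & forall j : 'I_n, (j < i)%N -> a j = 0.
Proof.
case/existsP=> i /existsP[k /andP[ik /orP[]/eqP->]]; exists i => [|j ji]; rewrite !ffunE.
- by rewrite eqxx; case: eqP => [e|]; rewrite ?addr0 //; move: ik; rewrite e ltnn.
- by rewrite !ltn_eqF // (ltn_trans ji).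
- by rewrite eqxx; case: eqP => [e|]; rewrite ?subr0 //; move: ik; rewrite e ltnn.
- by rewrite !ltn_eqF // (ltn_trans ji).
Qed.

Lemma pos_gl (j k : 'I_n) : isPosRoot (wt (lshift n j) - wt (lshift n k)) -> (j < k)%N.
Proof.
case/posroot_lead=> i; rewrite !ffunE !wtE !eq_lshift !eq_lrshift !subr0.
have [->|_] := eqVneq j i; last by case: eqP.
have [//|neq _ h] := eqVneq k i.
have [//|ki|e] := ltngtP i k; last by rewrite (val_inj e) eqxx in neq.
move: (h k ki); rewrite !ffunE !wtE !eq_lshift !eq_lrshift !subr0 eqxx.
by rewrite eq_sym (negbTE neq).
Qed.

Local Notation oa := (oa hn).
Local Notation ob := (ob hn).

(** The positive roots of so(4) are eps_(n-1) +- eps_n, each named by two index pairs. *)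
Lemma pos_mid p q : mid p -> mid q -> isPosRoot (wt q - wt p) ->
  (q = lshift n oa /\ (p = lshift n ob \/ p = rshift n ob)) \/
  (p = rshift n oa /\ (q = lshift n ob \/ q = rshift n ob)).
Proof.
move=> mp mq /posroot_lead[i ei hi].
have ab : (oa < ob)%N by rewrite /=; lia.
have nab : (oa == ob) = false by rewrite -val_eqE /= ltn_eqF.
have nba : (ob == oa) = false by rewrite eq_sym.
have li : i = oa \/ i = ob.
  have [li|gi] := ltnP i (n - 2); last exact: oab_ge.
  by move: ei; rewrite !ffunE !wt_mid.
have h1 : (wt q - wt p) oa = 1 \/ (wt q - wt p) oa = 0 /\ (wt q - wt p) ob = 1.
  by case: li ei hi => -> ei hi; [left|right; split=> //; apply: hi].
move: h1; rewrite !ffunE !wtE.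
have [k + +] := midE hn mp; have [l + +] := midE hn mq.
move=> [] -> [] -> [] -> [] ->; rewrite ?eq_lshift ?eq_rshift ?eq_lrshift ?eq_rlshift ?eqxx ?nab ?nba;
  (try by case=> [|[]]); auto.
Qed.

End PositiveRoots.

(** * Explicit lowest weight tensors with nonzero form *)

Section LowestVectors.
Variables (C : numClosedFieldType) (n : nat) (hn : (5 <= n)%N).
Local Notation so2n := (@so2n C n).
Local Notation lie := (@lie C n).
Local Notation kill := (@kill C n).
Local Notation rv := (@rv C n).
Local Notation o1 := (o1 hn).
Local Notation o2 := (o2 hn).
Local Notation oa := (oa hn).
Local Notation ob := (ob hn).
Local Notation a := (rshift n oa).
Implicit Types (p q : 'I_(n + n)).

(** Linearity reduces the lowering condition to root vectors of gl(n-2) and so(4); the mirrored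
    block of gl(n-2) follows by sign. *)
Lemma lowW_intro (nu : weight n) (I : finType) (F G : I -> 'M[C]_(n + n)) :
  (forall i, gr 0 (F i)) -> (forall i, gr (-2) (G i)) ->
  (forall i, exists w, rootsp w (F i) /\ rootsp (- nu - w) (G i)) ->
  let D Z := \sum_i (tens (lie Z (F i)) (G i) + tens (F i) (lie Z (G i))) in
  (forall j k : 'I_n, (j < k)%N -> (k < n - 2)%N -> D (rv (lshift n k) (lshift n j)) = 0) ->
  (forall p q, mid p -> mid q -> isPosRoot (wt q - wt p) -> D (rv p q) = 0) ->
  lowW nu (\sum_i tens (F i) (G i)).
Proof.
move=> hF hG hw D Dgl Dmid; have actE Z : actT Z (\sum_i tens (F i) (G i)) = D Z.
  by rewrite actT_sum; apply: eq_bigr => i _; rewrite actT_tens.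
split; first by apply: in_l_zbar_sum => i; apply: in_l_zbar_tens.
split=> [H hH|w Z pw hZ lZ].
  rewrite actE /D scaler_sumr; apply: eq_bigr => i _; have [w [[_ h1] [_ h2]]] := hw i.
  by rewrite h1 // h2 // tensZl tensZr -scalerDl -evwD addrC subrK.
rewrite actE; apply: (so_ind (P := fun Z => D Z = 0) (gr_so lZ)).
- by rewrite /D big1 // => i _; rewrite !lie0l tens0l tens0r addr0.
- move=> c U W hU hW.
  have -> : D (c *: U + W) = c *: D U + D W.
    rewrite /D scaler_sumr -big_split; apply: eq_bigr => i _ /=.
    by rewrite !lieDl tensDl tensDr tensZl tensZr scalerDr addrACA.
  by rewrite hU hW scaler0 addr0.
have DN Z' : D (- Z') = - D Z'.
  rewrite /D -sumrN; apply: eq_bigr => i _.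
  rewrite -scaleN1r -[-1 *: Z']addr0 !lieDl !lie0l !addr0 tensZl tensZr -scalerDr.
  by rewrite scaleN1r.
move=> p q nz; have dpq := gr_entry lZ nz; have wpq := rootsp_entry hZ nz.
have {wpq} pw' : isPosRoot (wt q - wt p) by rewrite -opprB wpq opprK.
move: dpq pw' => {nz}; case: (degP p) => [j lj|j lj|{}p mp]; case: (degP q) => [k lk|k lk|{}q mq] //= _ pw'.
- by apply: Dgl => //; apply: pos_gl.
- rewrite -!cjl rv_cj DN Dgl ?oppr0 //; apply: pos_gl.
  by move: pw'; rewrite -!cjl !wt_cj opprK addrC.
- exact: Dmid.
Qed.

Definition widen_idx (i : 'I_(n - 2)) : 'I_n := widen_ord (leq_subr 2 n) i.

Lemma widen_idx_lt i : (widen_idx i < n - 2)%N. Proof. exact: (ltn_ord i). Qed.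

(** The weights eps_i - eps_1 and -eps_i - eps_1 add up to -2 eps_1 for every i. Summing over i
    contracts C^(n-2) with its dual, which makes the lowering operators cancel in pairs. *)
Definition lowtens0 : Tens C n :=
  \sum_i tens (rv (lshift n (widen_idx i)) (lshift n o1)) (rv (rshift n (widen_idx i)) (lshift n o1)).

(** A product of lowest weight vectors: of one simple ideal of so(4), with weight wt a + wt b, and
    of z(nbar), with weight -eps_1 - eps_2. *)
Definition lowtens1 b : Tens C n := tens (rv a (cj b)) (rv (rshift n o2) (lshift n o1)).

Lemma lie_mid_gl p q (j k : 'I_n) : mid p -> mid q -> (j < n - 2)%N -> (k < n - 2)%N ->
  lie (rv p q) (rv (lshift n j) (lshift n k)) = 0.
Proof.
move=> mp mq lj lk; rewrite lie_rv !cjl !(eq_sym (lshift n k)) !mid_lF // !mid_rF //.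
by rewrite !scale0r !subr0 addr0.
Qed.

Lemma lie_mid_z p q (j k : 'I_n) : mid p -> mid q -> (j < n - 2)%N -> (k < n - 2)%N ->
  lie (rv p q) (rv (rshift n j) (lshift n k)) = 0.
Proof.
move=> mp mq lj lk; rewrite lie_rv !cjl !cjr !(eq_sym (lshift n k)) !mid_lF // !mid_rF //.
by rewrite !scale0r !subr0 addr0.
Qed.

Lemma lie_gl_mid p q (j k : 'I_n) : mid p -> mid q -> (j < n - 2)%N -> (k < n - 2)%N ->
  lie (rv (lshift n j) (lshift n k)) (rv p q) = 0.
Proof. by move=> mp mq lj lk; rewrite lieC lie_mid_gl // oppr0. Qed.

Section WithB.
Variables (b : 'I_(n + n)) (hb : b = lshift n ob \/ b = rshift n ob).

Lemma lowtens1_low : lowW (nu1 hn b) (lowtens1 b).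
Proof.
have [ma mb ab acb] := ab_facts hb; have mcb : mid (cj b) by rewrite mid_cj.
have l1 := o1_lt hn; have l2 := o2_lt hn.
have -> : lowtens1 b = \sum_(i : 'I_1) tens (rv a (cj b)) (rv (rshift n o2) (lshift n o1)).
  by rewrite big_ord1.
apply: lowW_intro.
- by move=> _; apply: gr_rvE; rewrite (eqP ma) (eqP mcb).
- by move=> _; apply: gr_rvE; rewrite degl degr l1 l2.
- move=> _; exists (wt a - wt (cj b)); split; first exact: rootsp_rv.
  have -> : - nu1 hn b - (wt a - wt (cj b)) = wt (rshift n o2) - wt (lshift n o1).
    rewrite /nu1 wt_cj -[in RHS]cjl wt_cj; apply/ffunP => i; rewrite !ffunE; ring.
  exact: rootsp_rv.
- move=> j k jk lk; have lj := ltn_trans jk lk.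
  rewrite big_ord1 lie_gl_mid // tens0l add0r lie_rv !cjl !cjr !eq_lrshift !eq_lshift.
  have [e|_] := eqVneq o1 k; first by move: jk; rewrite -e.
  have [e|_] := eqVneq k o2; last by rewrite !scale0r !subr0 addr0 tens0r.
  have -> : j = o1 by apply: val_inj; move: jk; rewrite e /=; case: (j : nat).
  have -> : rv (rshift n o1) (lshift n o1) = 0 by rewrite -cjr rv_cj0.
  by rewrite scaler0 !scale0r !subr0 addr0 tens0r.
- move=> p q mp mq pos; rewrite big_ord1 lie_mid_z // tens0r addr0.
  have nab : (oa == ob) = false by rewrite -val_eqE /=; lia.
  have nba : (ob == oa) = false by rewrite eq_sym.
  have z : rv a (lshift n oa) = 0 by rewrite -cjr rv_cj0.
  have -> : lie (rv p q) (rv a (cj b)) = 0; last by rewrite tens0l.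
  rewrite lie_rv !cjr !cjK.
  case: (pos_mid hn mp mq pos) => [[-> [] ->]|[-> [] ->]]; case: hb => ->;
  rewrite ?cjl ?cjr ?eq_lshift ?eq_rshift ?eq_lrshift ?eq_rlshift ?nab ?nba ?eqxx ?z ?scale0r ?scaler0 ?subr0 ?addr0 //.
Qed.

Lemma lowtens1_val : bform (lowtens1 b) (xg C (o1, a)) (xg C (o2, b)) = kap C n / 2%:R.
Proof.
have [ma mb ab acb] := ab_facts hb; have l1 := o1_lt hn; have l2 := o2_lt hn.
rewrite bform_tens; last by apply: gr_rvE; rewrite degl degr l1 l2.
have o12 : (o1 == o2) = false by [].
have o21 : (o2 == o1) = false by [].
rewrite /quart /xg /fst /snd.
have -> : lie (rv (lshift n o2) b) (rv (rshift n o2) (lshift n o1)) = rv (rshift n o1) b.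
  rewrite lie_rv !cjl !cjr eqxx eq_lshift o12 !mid_rF //.
  by rewrite !scale0r scale1r ?subr0 ?sub0r ?oppr0 ?add0r ?addr0.
have -> : lie (rv (lshift n o1) a) (rv (rshift n o1) b) = rv (cj b) a.
  rewrite lie_rv ?cjl ?cjr eqxx mid_rF // mid_lF // (negbTE acb).
  by rewrite !scale0r scale1r ?subr0 ?sub0r ?oppr0 ?add0r ?addr0.
have -> : lie (rv (lshift n o1) a) (rv (rshift n o2) (lshift n o1)) = - rv (rshift n o2) a.
  rewrite lie_rv ?cjl ?cjr eqxx !mid_rF // eq_lshift o12.
  by rewrite !scale0r scale1r ?subr0 ?addr0 ?sub0r.
have -> : lie (rv (lshift n o2) b) (- rv (rshift n o2) a) = rv (cj b) a.
  have bca : (b == lshift n oa) = false by rewrite -cjr -cj_eq eq_sym (negbTE acb).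
  rewrite lieNr lie_rv !cjr eqxx mid_rF // mid_lF // bca.
  by rewrite !scale0r scale1r ?subr0 ?sub0r ?oppr0 ?add0r ?addr0 -rv_cj cjl.
rewrite kill_rv ?so_rv // rvE !eqxx cjK (eq_sym a b) [b == a]eq_sym (negbTE ab) mul0r subr0 !mulr1.
by field.
Qed.
End WithB.

Lemma lowtens0_low : lowW (nu0 hn) lowtens0.
Proof.
have l1 := o1_lt hn; apply: lowW_intro.
- by move=> i; apply: gr_rvE; rewrite !degl l1 widen_idx_lt.
- by move=> i; apply: gr_rvE; rewrite degl degr l1 widen_idx_lt.
- move=> i; exists (wt (lshift n (widen_idx i)) - wt (lshift n o1)); split; first exact: rootsp_rv.
  have -> : - nu0 hn - (wt (lshift n (widen_idx i)) - wt (lshift n o1)) = wt (rshift n (widen_idx i)) - wt (lshift n o1).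
    by rewrite /nu0 -[in RHS]cjl wt_cj; apply/ffunP => k; rewrite !ffunE; ring.
  exact: rootsp_rv.
- move=> j k jk lk; have lj := ltn_trans jk lk.
  have nk : (o1 == k) = false by apply/eqP => e; move: jk; rewrite -e.
  have e1 i : lie (rv (lshift n k) (lshift n j)) (rv (lshift n (widen_idx i)) (lshift n o1)) =
      (widen_idx i == j)%:R *: rv (lshift n k) (lshift n o1).
    rewrite lie_rv !cjl !eq_lrshift !eq_lshift nk (eq_sym j).
    by rewrite !scale0r ?subr0 ?addr0.
  have e2 i : lie (rv (lshift n k) (lshift n j)) (rv (rshift n (widen_idx i)) (lshift n o1)) =
      - ((widen_idx i == k)%:R *: rv (rshift n j) (lshift n o1)).
    have en : rv (rshift n o1) (lshift n j) = - rv (rshift n j) (lshift n o1) by rewrite -rv_cj cjl cjr.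
    rewrite lie_rv ?cjl ?cjr !eq_lrshift !eq_lshift nk (eq_sym k) en scalerN.
    by rewrite !scale0r ?subr0 ?add0r.
  have sel (m : 'I_n) (lm : (m < n - 2)%N) (F : 'I_n -> Tens C n) :
      \sum_i (widen_idx i == m)%:R *: F (widen_idx i) = F m.
    have em : widen_idx (Ordinal lm) = m by apply: val_inj.
    rewrite (bigD1 (Ordinal lm)) //= em eqxx scale1r big1 ?addr0 // => i neq.
    case: eqP => [e|]; last by rewrite scale0r.
    by case/eqP: neq; apply: val_inj; rewrite /= -[in RHS]e.
  transitivity (\sum_i ((widen_idx i == j)%:R *: tens (rv (lshift n k) (lshift n o1)) (rv (rshift n (widen_idx i)) (lshift n o1))
     - (widen_idx i == k)%:R *: tens (rv (lshift n (widen_idx i)) (lshift n o1)) (rv (rshift n j) (lshift n o1)))).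
    by apply: eq_bigr => i _; rewrite e1 e2 tensZl -scaleNr tensZr scaleNr.
  rewrite sumrB (sel j lj (fun i => tens (rv (lshift n k) (lshift n o1)) (rv (rshift n i) (lshift n o1)))).
  by rewrite (sel k lk (fun i => tens (rv (lshift n i) (lshift n o1)) (rv (rshift n j) (lshift n o1)))) subrr.
- move=> p q mp mq _; rewrite big1 // => i _.
  by rewrite lie_mid_gl ?widen_idx_lt // lie_mid_z ?widen_idx_lt // tens0l tens0r addr0.
Qed.

(** The summand i = 1 vanishes, as -2 eps_1 is not a root; the other n - 3 contribute equally, and n
    - 3 is nonzero for n >= 5. *)
Lemma lowtens0_val : bform lowtens0 (xg C (o1, lshift n oa)) (xg C (o1, rshift n oa)) =
  (n - 3)%:R * (kap C n / 2%:R).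
Proof.
have l1 := o1_lt hn; have ml := mid_oa hn; have mr : mid a by rewrite -cjl mid_cj.
rewrite bform_sum; have h0 : (0 < n - 2)%N by lia.
have e0 : widen_idx (Ordinal h0) = o1 by apply: val_inj.
have lie1 (q : 'I_(n + n)) (i : 'I_n) : mid q -> (i < n - 2)%N -> o1 != i ->
    lie (rv (lshift n o1) q) (rv (rshift n i) (lshift n o1)) = - rv (rshift n i) q.
  move=> mq li /negbTE ni; rewrite lie_rv ?cjl ?cjr eqxx !mid_rF // eq_lshift ni.
  by rewrite !scale0r scale1r ?subr0 ?addr0 ?sub0r.
have lie2 (q : 'I_(n + n)) (i : 'I_n) : mid q -> (i < n - 2)%N -> o1 != i ->
    lie (rv (lshift n o1) q) (- rv (rshift n i) (cj q)) = rv (lshift n o1) (lshift n i).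
  move=> mq li /negbTE ni; have mcq : mid (cj q) by rewrite mid_cj.
  rewrite lieNr lie_rv cjK cjr eqxx mid_rF // mid_lF // eq_lshift ni.
  by rewrite !scale0r scale1r ?subr0 ?addr0 ?sub0r opprK.
rewrite (bigD1 (Ordinal h0)) //= e0.
have -> : rv (rshift n o1) (lshift n o1) = 0 by rewrite -cjr rv_cj0.
rewrite tens0r bform0 add0r (eq_bigr (fun=> kap C n / 2%:R)).
  rewrite sumr_const cardC1 card_ord -[LHS]mulr_natl; have -> : ((n - 2).-1 = n - 3)%N by lia.
  by [].
move=> i neq; have ni : o1 != widen_idx i.
  by apply: contraNneq neq => e; apply/eqP/val_inj; rewrite -[LHS]/(val (widen_idx i)) -e.
have li := widen_idx_lt i.
rewrite bform_tens; last by apply: gr_rvE; rewrite degl degr l1 li.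
rewrite /quart /xg /fst /snd !lie1 //.
have -> : lie (rv (lshift n o1) (lshift n oa)) (- rv (rshift n (widen_idx i)) a) = rv (lshift n o1) (lshift n (widen_idx i)).
  by rewrite -(lie2 _ _ ml li ni) cjl.
have -> : lie (rv (lshift n o1) a) (- rv (rshift n (widen_idx i)) (lshift n oa)) = rv (lshift n o1) (lshift n (widen_idx i)).
  by rewrite -(lie2 _ _ mr li ni) cjr.
rewrite kill_rv ?so_rv // rvE !eqxx cjl eq_lrshift mul0r subr0 !mulr1.
by field.
Qed.

End LowestVectors.

(** * A module generated by a vector of type C_(-s) *)

Section FrameFields.
Variable R : comNzRingType.

Definition is_derivation (d : R -> R) : Prop :=
  (forall x y, d (x - y) = d x - d y) /\ (forall x y, d (x * y) = d x * y + x * d y).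

Section Leibniz.
Variables (d : R -> R) (hd : is_derivation d).

Lemma derivation0 : d 0 = 0.
Proof. by case: hd => h _; have := h 0 0; rewrite !subrr. Qed.

Lemma derivationD x y : d (x + y) = d x + d y.
Proof. by case: hd => h _; rewrite -[y in LHS]opprK h -[- y]sub0r h derivation0 sub0r opprK. Qed.

Lemma derivation_sum (I : Type) (s : seq I) (P : pred I) (F : I -> R) :
  d (\sum_(i <- s | P i) F i) = \sum_(i <- s | P i) d (F i).
Proof. by elim/big_rec2: _ => [|i y U _ <-]; rewrite ?derivation0 ?derivationD. Qed.

Lemma derivation_mulmx m n l (A : 'M[R]_(m, n)) (B : 'M_(n, l)) :
  map_mx d (A *m B) = map_mx d A *m B + A *m map_mx d B.
Proof.
apply/matrixP => i j; rewrite !mxE derivation_sum -big_split; apply: eq_bigr => r _ /=.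
by rewrite !mxE; case: hd.
Qed.

Lemma derivation_subm m n (A B : 'M[R]_(m, n)) :
  map_mx d (A - B) = map_mx d A - map_mx d B.
Proof. by apply/matrixP => i j; rewrite !mxE; case: hd. Qed.

Lemma derivation_tr m (A : 'M[R]_m) : d (\tr A) = \tr (map_mx d A).
Proof. by rewrite /mxtrace derivation_sum; apply: eq_bigr => i _; rewrite mxE. Qed.

Variables (m : nat) (b e F f : 'M[R]_m).
Hypotheses (db : map_mx d b = 0) (de : map_mx d e = 0) (dF : map_mx d F = f).

Lemma derivation_field : map_mx d (b *m F - F *m e *m b *m F) =
  b *m f - f *m e *m b *m F - F *m e *m b *m f.
Proof.
rewrite derivation_subm !derivation_mulmx db de dF !mul0mx !mulmx0 !add0r !addr0.
by rewrite opprD addrA.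
Qed.

Lemma derivation_theta : d (\tr (e *m b *m F)) = \tr (e *m b *m f).
Proof. by rewrite derivation_tr !derivation_mulmx db de dF mul0mx mulmx0 addr0 mul0mx add0r. Qed.

End Leibniz.

(* [F -> a F - F e a F] is the action of [a] on frames [F] normalised by
   [e F = e]; it turns the matrix commutator into minus the bracket of fields. *)
Section Bracket.
Variables (m : nat) (a b e F : 'M[R]_m) (da db : R -> R).
Let fld x := x *m F - F *m e *m x *m F.
Hypotheses (hda : is_derivation da) (hdb : is_derivation db).
Hypotheses (dab : map_mx da b = 0) (dba : map_mx db a = 0).
Hypotheses (dae : map_mx da e = 0) (dbe : map_mx db e = 0).
Hypotheses (daF : map_mx da F = fld a) (dbF : map_mx db F = fld b).

Lemma field_bracket : map_mx da (fld b) - map_mx db (fld a) = - fld (a *m b - b *m a).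
Proof.
rewrite /fld (derivation_field hda dab dae daF) (derivation_field hdb dba dbe dbF) /fld.
rewrite !(mulmxBr, mulmxBl) !mulmxA.
move: (b *m a *m F) (b *m F *m e *m a *m F) (a *m F *m e *m b *m F)
  (F *m e *m a *m F *m e *m b *m F) (F *m e *m b *m a *m F)
  (F *m e *m b *m F *m e *m a *m F) (a *m b *m F) (F *m e *m a *m b *m F) => x1 x2 x3 x4 x5 x6 x7 x8.
by apply/matrixP => p q; rewrite !mxE; ring.
Qed.

Lemma theta_bracket : da (\tr (e *m b *m F)) - db (\tr (e *m a *m F)) =
  - \tr (e *m (a *m b - b *m a) *m F).
Proof.
rewrite (derivation_theta hda dab dae daF) (derivation_theta hdb dba dbe dbF) /fld.
rewrite !(mulmxBr, mulmxBl) !mulmxA !raddfB /=.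
(* Cyclicity of the trace makes the terms quadratic in F cancel. *)
have -> : \tr (e *m b *m F *m e *m a *m F) = \tr (e *m a *m F *m e *m b *m F).
  have -> : e *m b *m F *m e *m a *m F = (e *m b *m F) *m (e *m a *m F) by rewrite !mulmxA.
  by rewrite mxtrace_mulC !mulmxA.
ring.
Qed.

End Bracket.
End FrameFields.

Section Derivations.
Variables (R : comNzRingType) (k : nat).
Implicit Types (p q : {mpoly R[k]}) (c d : 'I_k -> {mpoly R[k]}).

Definition der c p : {mpoly R[k]} := \sum_i c i * p^`M(i).

Lemma mderiv_var i j : ('X_i : {mpoly R[k]})^`M(j) = (i == j)%:R.
Proof.
rewrite mderivX mnm1E; case: eqP => [->|_]; last by rewrite scale0r.
by rewrite scale1r -mpolyX0; congr 'X_[_]; apply/mnmP => l; rewrite mnmBE subnn mnm0E.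
Qed.

Lemma der_var c i : der c 'X_i = c i.
Proof.
rewrite /der (bigD1 i) //= mderiv_var eqxx mulr1 big1 ?addr0 // => j neq.
by rewrite mderiv_var eq_sym (negbTE neq) mulr0.
Qed.

Lemma der_lin c a p q : der c (a *: p + q) = a *: der c p + der c q.
Proof.
rewrite /der scaler_sumr -big_split; apply: eq_bigr => i _ /=.
by rewrite mderivD mderivZ mulrDr scalerAr.
Qed.

Lemma der0 c : der c 0 = 0.
Proof. by rewrite /der big1 // => i _; rewrite mderiv0 mulr0. Qed.

Lemma derC c a : der c a%:MP = 0.
Proof. by rewrite /der big1 // => i _; rewrite mderivC mulr0. Qed.

Lemma der_add c p q : der c (p + q) = der c p + der c q.
Proof. by rewrite -[p in LHS]scale1r der_lin scale1r. Qed.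

Lemma der_opp c p : der c (- p) = - der c p.
Proof. by rewrite -scaleN1r -[-1 *: p]addr0 der_lin der0 addr0 scaleN1r. Qed.

Lemma der_sum c (I : Type) (s : seq I) (P : pred I) (F : I -> {mpoly R[k]}) :
  der c (\sum_(i <- s | P i) F i) = \sum_(i <- s | P i) der c (F i).
Proof. by elim/big_rec2: _ => [|i y U _ <-]; rewrite ?der0 ?der_add. Qed.

Lemma derM c p q : der c (p * q) = der c p * q + p * der c q.
Proof.
rewrite /der mulr_suml mulr_sumr -big_split; apply: eq_bigr => i _ /=.
by rewrite mderivM; ring.
Qed.

(** The second-order parts cancel because partial derivatives commute. *)
Lemma der_comm c d p :
  der c (der d p) - der d (der c p) = \sum_i (der c (d i) - der d (c i)) * p^`M(i).
Proof.
have E a b : der a (der b p) = \sum_i der a (b i) * p^`M(i) +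
    \sum_i \sum_j b i * a j * p^`M(i)^`M(j).
  rewrite {2}/der der_sum -big_split; apply: eq_bigr => i _ /=.
  by rewrite derM; congr (_ + _); rewrite /der mulr_sumr; apply: eq_bigr => j _; rewrite mulrA.
rewrite !E [X in _ - (_ + X)]exchange_big /=.
have -> : \sum_j \sum_i c i * d j * p^`M(i)^`M(j) = \sum_i \sum_j d i * c j * p^`M(i)^`M(j).
  by apply: eq_bigr => i _; apply: eq_bigr => j _; rewrite mderiv_comm mulrAC [in RHS]mulrAC [c _ * _]mulrC [RHS]mulrAC; ring.
rewrite opprD addrACA subrr addr0 -sumrB; apply: eq_bigr => i _.
by rewrite mulrBl.
Qed.

Lemma der_is_derivation c : is_derivation (der c).
Proof. by split=> p q; [rewrite der_add der_opp | exact: derM]. Qed.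

Lemma der_constmx c m n (A : 'M[R]_(m, n)) : map_mx (der c) (map_mx (@mpolyC k R) A) = 0.
Proof. by apply/matrixP => i j; rewrite !mxE derC. Qed.

End Derivations.

(** * The twisted action on polynomials in frame coordinates *)

Section Module.
Variables (C : numClosedFieldType) (n : nat).
Local Notation lie := (@lie C n).
Local Notation rv := (@rv C n).
Local Notation Ix := (bool * ('I_(n + n) * 'I_(n + n)))%type.
Variables (nv : nat) (idx : Ix -> 'I_nv) (unidx : 'I_nv -> Ix).
Hypothesis idxK : cancel idx unidx.
Local Notation P := {mpoly C[nv]}.
Implicit Types (A B Z : 'M[C]_(n + n)) (p q : 'I_(n + n)) (t : bool).

Definition var t p q : P := 'X_(idx (t, (p, q))).
Definition cmx A : 'M[P]_(n + n) := locked (map_mx (@mpolyC nv C) A).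
Definition proj0 : 'M[C]_(n + n) := \matrix_(p, q) ((p == q) && (deg p == -1))%:R.
Definition proj : 'M[P]_(n + n) := locked (cmx proj0).

Lemma projE : proj = cmx proj0. Proof. by rewrite /proj -lock. Qed.

(** The n - 2 columns of degree -1 span a moving plane, normalised to be the identity on the rows of
    degree -1: an affine chart of the Grassmannian. The other columns are carried along so that all
    matrices stay square. *)
Definition frame t : 'M[P]_(n + n) :=
  locked (\matrix_(p, q) if deg p == -1 then (p == q)%:R else var t p q).
Definition frame_field t A : 'M[P]_(n + n) :=
  locked (cmx A *m frame t - frame t *m proj *m cmx A *m frame t).

Lemma cmxE A : cmx A = map_mx (@mpolyC nv C) A. Proof. by rewrite /cmx -lock. Qed.

Lemma frameE t p q : frame t p q = if deg p == -1 then (p == q)%:R else var t p q.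
Proof. by rewrite /frame -lock mxE. Qed.

Lemma fieldE t A : frame_field t A = cmx A *m frame t - frame t *m proj *m cmx A *m frame t.
Proof. by rewrite /frame_field -lock. Qed.

Definition frame_coef A (i : 'I_nv) : P :=
  let x := unidx i in frame_field x.1 A x.2.1 x.2.2.
(* Sealed: unfolding [frame_der] or [theta] makes conversion explode. *)
Fact frame_der_sig : {d : 'M[C]_(n + n) -> P -> P | forall A, d A = der (frame_coef A)}.
Proof. by exists (fun A => der (frame_coef A)). Qed.
Definition frame_der := sval frame_der_sig.
Local Notation D := frame_der.

Lemma frame_derE A : D A = der (frame_coef A). Proof. exact: (svalP frame_der_sig). Qed.

Lemma frame_der_lin A a u w : D A (a *: u + w) = a *: D A u + D A w.
Proof. by rewrite frame_derE der_lin. Qed.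

Lemma frame_der_is_derivation A : is_derivation (D A).
Proof. by rewrite frame_derE; apply: der_is_derivation. Qed.

Lemma frame_derC A c : D A c%:MP = 0. Proof. by rewrite frame_derE derC. Qed.

Lemma proj_mulE (F : 'M[P]_(n + n)) p q : (proj *m F) p q = (deg p == -1)%:R * F p q.
Proof.
rewrite projE cmxE mxE (bigD1 p) //= !mxE eqxx /= mpolyC_nat big1 ?addr0 // => r neq.
by rewrite !mxE eq_sym (negbTE neq) mpolyC0 mul0r.
Qed.

Lemma proj_frame t : proj *m frame t = proj.
Proof.
apply/matrixP => p q; rewrite proj_mulE frameE projE cmxE !mxE mpolyC_nat andbC -mulnb natrM.
by case: (deg p == -1); rewrite ?mul0r.
Qed.

Lemma proj_idem : proj *m proj = proj.
Proof.
apply/matrixP => p q; rewrite proj_mulE projE cmxE !mxE !mpolyC_nat -natrM mulnb andbCA andbb.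
by [].
Qed.

(** The field is tangent to the normalisation, so differentiating the frame is also correct at its
    constant entries. *)
Lemma proj_field t A : proj *m frame_field t A = 0.
Proof. by rewrite fieldE mulmxBr !mulmxA proj_frame proj_idem subrr. Qed.

Lemma der_frame t A : map_mx (D A) (frame t) = frame_field t A.
Proof.
apply/matrixP => p q; rewrite [LHS]mxE frameE.
case: ifP => dp; last by rewrite frame_derE der_var /frame_coef idxK.
have := congr1 (fun M : 'M_(n + n) => M p q) (proj_field t A).
rewrite proj_mulE dp mul1r [RHS]mxE => ->.
by rewrite -mpolyC_nat frame_derC.
Qed.

Lemma der_proj A : map_mx (D A) proj = 0.
Proof. by rewrite projE cmxE frame_derE der_constmx. Qed.

Lemma der_cmx A B : map_mx (D A) (cmx B) = 0.
Proof. by rewrite cmxE frame_derE der_constmx. Qed.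

Lemma cmx_lie A B : cmx (lie A B) = cmx A *m cmx B - cmx B *m cmx A.
Proof. by rewrite !cmxE map_mxB !map_mxM. Qed.

Lemma field_lie t A B :
  map_mx (D A) (frame_field t B) - map_mx (D B) (frame_field t A) = - frame_field t (lie A B).
Proof.
rewrite !fieldE cmx_lie; apply: (field_bracket (frame_der_is_derivation _) (frame_der_is_derivation _));
  by rewrite ?der_cmx ?der_proj ?der_frame ?fieldE.
Qed.

(** The trace of the compensating factor e A F, the infinitesimal form of a determinant character;
    hence the cocycle rule [theta_lie]. *)
Fact theta_sig : {f : bool -> 'M[C]_(n + n) -> P | forall t A, f t A = \tr (proj *m cmx A *m frame t)}.
Proof. by exists (fun t A => \tr (proj *m cmx A *m frame t)). Qed.
Definition theta := sval theta_sig.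

Lemma theta_tr t A : theta t A = \tr (proj *m cmx A *m frame t).
Proof. exact: (svalP theta_sig). Qed.

Lemma theta_lie t A B : D A (theta t B) - D B (theta t A) = - theta t (lie A B).
Proof.
rewrite !theta_tr cmx_lie; apply: (theta_bracket (frame_der_is_derivation _) (frame_der_is_derivation _));
  by rewrite ?der_cmx ?der_proj ?der_frame ?fieldE.
Qed.

Lemma cmx_lin a A B : cmx (a *: A + B) = a%:MP *: cmx A + cmx B.
Proof. by rewrite !cmxE map_mxD map_mxZ. Qed.

Lemma field_lin t a A B : frame_field t (a *: A + B) = a%:MP *: frame_field t A + frame_field t B.
Proof.
rewrite !fieldE cmx_lin !(mulmxDl, mulmxDr) -!scalemxAr -!scalemxAl scalerBr opprD.
by rewrite addrACA.
Qed.

Lemma D_lin a A B u : D (a *: A + B) u = a *: D A u + D B u.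
Proof.
rewrite !frame_derE /der scaler_sumr -big_split; apply: eq_bigr => i _ /=.
by rewrite /frame_coef field_lin mxE mxE mulrDl -mulrA mul_mpolyC.
Qed.

Lemma theta_lin t a A B : theta t (a *: A + B) = a *: theta t A + theta t B.
Proof.
rewrite !theta_tr cmx_lin mulmxDr mulmxDl -!scalemxAr -!scalemxAl linearD linearZ /=.
by rewrite mul_mpolyC.
Qed.

Variable s : C.

(* The weight s is split as (s - 1) + 1 over two commuting copies of the
   coordinates, so that g(-1) does not kill the generator even at s = 0. *)
Fact twist_sig : {f : 'M[C]_(n + n) -> P | forall A, f A = (s - 1) *: theta false A + theta true A}.
Proof. by exists (fun A => (s - 1) *: theta false A + theta true A). Qed.
Definition twist := sval twist_sig.

Lemma twistE A : twist A = (s - 1) *: theta false A + theta true A.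
Proof. exact: (svalP twist_sig). Qed.

(** The fields reverse brackets, so they enter with a minus sign; [twist] obeys the matching cocycle
    rule. *)
Definition frame_rho A (u : P) : P := twist A * u - D A u.

Lemma field_lie_entry t A B p q :
  D A (frame_field t B p q) - D B (frame_field t A p q) = - frame_field t (lie A B) p q.
Proof.
have E (d1 d2 : P -> P) (M1 M2 M3 : 'M[P]_(n + n)) :
    map_mx d1 M1 - map_mx d2 M2 = - M3 -> d1 (M1 p q) - d2 (M2 p q) = - M3 p q.
  by move=> /(congr1 (fun M : 'M[P]_(n + n) => M p q)); rewrite !mxE.
exact: (E _ _ _ _ _ (field_lie t A B)).
Qed.

Lemma D_lie A B u : D A (D B u) - D B (D A u) = - D (lie A B) u.
Proof.
rewrite !frame_derE der_comm [in RHS]/der -sumrN; apply: eq_bigr => i _; rewrite -mulNr; congr (_ * _).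
by have := field_lie_entry (unidx i).1 A B (unidx i).2.1 (unidx i).2.2; rewrite !frame_derE.
Qed.

Lemma twist_lie A B : D A (twist B) - D B (twist A) = - twist (lie A B).
Proof.
have h1 := theta_lie false A B.
have h2 := theta_lie true A B.
rewrite !twistE !frame_der_lin.
move: (theta false (lie A B)) (theta true (lie A B)) h1 h2 => x y.
move: (D A (theta false B)) (D A (theta true B)) => u v.
move: (D B (theta false A)) (D B (theta true A)) => w z h1 h2.
rewrite opprD addrACA -scalerBr.
rewrite h1 h2.
by rewrite scalerN -opprD.
Qed.

Lemma twist_lin a A B : twist (a *: A + B) = a *: twist A + twist B.
Proof.
rewrite !twistE !theta_lin; move: (theta false A) (theta false B) (theta true A) (theta true B) => x y z w.
by rewrite !scalerDr !scalerA [_ * a]mulrC addrACA.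
Qed.

Lemma twist_bracket (R : comNzRingType) (x y u a b ab ba xy yx : R) :
  x * (y * u - b) - ((xy * u + y * a) - ab) - (y * (x * u - a) - ((yx * u + x * b) - ba)) =
  - (xy - yx) * u + (ab - ba).
Proof. ring. Qed.

Lemma frame_rho_gmod : is_gmod frame_rho.
Proof.
split; [|split].
- move=> A _ a u w; rewrite /frame_rho frame_der_lin mulrDr scalerBr scalerAr.
  by rewrite opprD addrACA.
- move=> A B a u _ _; rewrite /frame_rho D_lin twist_lin mulrDl scalerBr scalerAl opprD.
  by rewrite addrACA.
- move=> A B u _ _; have [dB dM] := frame_der_is_derivation A; have [dB' dM'] := frame_der_is_derivation B.
  rewrite /frame_rho dB dM dB' dM' twist_bracket twist_lie D_lie opprK.
  by [].
Qed.

Lemma frame_rho1 A : frame_rho A 1 = twist A.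
Proof. by rewrite /frame_rho -[1]mpolyC1 frame_derC subr0 mulr1. Qed.

Lemma thetaE t A : theta t A =
  \sum_(p | deg p == -1) \sum_q (A p q)%:MP * frame t q p.
Proof.
rewrite theta_tr -mulmxA /mxtrace [RHS]big_mkcond; apply: eq_bigr => p _.
rewrite proj_mulE; case: eqP => _; rewrite ?mul0r // mul1r mxE.
by apply: eq_bigr => q _; rewrite cmxE mxE.
Qed.

(** Such an A preserves the span of the basis vectors of degree >= 0, hence the chart of planes
    complementary to it, on which it acts by affine fields; the cocycle is then constant. *)
Lemma theta_block t A : (forall p q, deg p = -1 -> deg q != -1 -> A p q = 0) ->
  theta t A = (\sum_(p | deg p == -1) A p p)%:MP.
Proof.
move=> hA; rewrite thetaE rmorph_sum; apply: eq_bigr => p /eqP dp /=.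
rewrite (bigD1 p) //= frameE dp !eqxx mulr1 big1 ?addr0 // => q neq.
rewrite frameE; case: eqP => [dq|/eqP dq]; first by rewrite (negbTE neq) mulr0.
by rewrite hA // mpolyC0 mul0r.
Qed.

Lemma twist_block A : (forall p q, deg p = -1 -> deg q != -1 -> A p q = 0) ->
  twist A = (s * \sum_(p | deg p == -1) A p p) *: 1.
Proof.
move=> hA; rewrite !twistE !theta_block // -[_%:MP]mulr1 mul_mpolyC scalerA -scalerDl.
by congr (_ *: _); ring.
Qed.

Lemma gr_block d A : 0 <= d -> gr d A -> forall p q, deg p = -1 -> deg q != -1 -> A p q = 0.
Proof.
move=> d0 gA p q dp dq; apply/eqP; apply: contraTT isT => nz; have := gr_entry gA nz.
by move: dq d0; case: (degP q) => //= *; lia.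
Qed.

Lemma frame_rho_Cms : is_Cms_vec s frame_rho 1.
Proof.
split; [|split].
- move=> H hH; rewrite frame_rho1 twist_block; last exact: gr_block (inh_gr0 hH).
  rewrite mulNr -mulrN; congr ((_ * _) *: _).
  rewrite big_mkcond big_split_ord /= big1 ?add0r; last by move=> i _; rewrite degl; case: ltnP.
  rewrite /evw -sumrN; apply: eq_bigr => i _; rewrite degr lambda_qE -cjl inh_cj //.
  by case: ltnP => _; rewrite ?mul0r ?oppr0 ?mul1r.
- move=> A B gA gB; rewrite frame_rho1.
  have gAB : gr 0 (lie A B) by rewrite -[0]addr0 gr_lie.
  rewrite twist_block; last exact: gr_block gAB.
  (* In degree 0 the block of a product is the product of the blocks, so the commutator has trace 0
     on that block. *)
  have E (U W : 'M[C]_(n + n)) : gr 0 U -> \sum_(p | deg p == -1) (U *m W) p p =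
      \sum_(p | deg p == -1) \sum_(q | deg q == -1) U p q * W q p.
    move=> gU; apply: eq_bigr => p /eqP dp; rewrite mxE [RHS]big_mkcond; apply: eq_bigr => q _.
    by case: eqP => // /eqP dq; rewrite (gr_block _ gU) ?mul0r.
  have -> : \sum_(p | deg p == -1) lie A B p p = 0; last by rewrite mulr0 scale0r.
  transitivity (\sum_(p | deg p == -1) ((A *m B) p p - (B *m A) p p)).
    by apply: eq_bigr => p _; rewrite !mxE.
  rewrite sumrB !E // [X in _ - X]exchange_big /=; apply/eqP; rewrite subr_eq0; apply/eqP.
  by apply: eq_bigr => p _; apply: eq_bigr => q _; rewrite mulrC.
- move=> Z [X1 [X2 [g1 [g2 ->]]]]; rewrite frame_rho1.
  have z p q : deg p = -1 -> (X1 + X2) p q = 0.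
    move=> dp; rewrite mxE.
    have E d (U : 'M[C]_(n + n)) : 0 < d -> gr d U -> U p q = 0.
      move=> d0 gU; apply/eqP; apply: contraTT isT => nz; have := gr_entry gU nz.
      by move: d0; case: (degP q) => //= *; lia.
    by rewrite (E 1) // (E 2) // addr0.
  rewrite twist_block; last by move=> p q dp _; apply: z.
  by rewrite big1 ?mulr0 ?scale0r // => p /eqP dp; apply: z.
Qed.

Lemma frame_rho_neq0 q (j : 'I_n) : mid q -> (j < n - 2)%N -> frame_rho (rv q (lshift n j)) 1 != 0.
Proof.
move=> mq lj; rewrite frame_rho1.
have E t : theta t (rv q (lshift n j)) = - var t (cj q) (rshift n j).
  rewrite thetaE (bigD1 (rshift n j)) ?degr ?lj //= [X in _ + X]big1 ?addr0.
    rewrite (bigD1 (cj q)) //= big1 ?addr0 => [|r neq].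
      rewrite rvE cjl !eqxx eq_sym mid_rF // mul0r sub0r mulr1 mpolyCN mpolyC1 mulN1r.
      by rewrite frameE deg_cj (eqP mq).
    by rewrite rvE cjl (eq_sym _ q) mid_rF // mul0r (negbTE neq) mulr0 subr0 mpolyC0 mul0r.
  move=> p /andP[dp neq]; rewrite big1 // => r _; rewrite rvE cjl (negbTE neq) mul0r.
  have -> : (p == q) = false by apply/eqP => e; move: dp; rewrite e (eqP mq).
  by rewrite mul0r subr0 mpolyC0 mul0r.
(* The coefficient is read in the copy carrying the character 1, so it does not depend on s. *)
apply/eqP => /(congr1 (mcoeff U_(idx (true, (cj q, rshift n j))))).
rewrite !twistE !E mcoeffD mcoeffZ !mcoeffN !mcoeffXU mcoeff0 eqxx.
rewrite (inj_eq (can_inj idxK)) xpair_eqE /= oppr0 mulr0 add0r => /eqP.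
by rewrite oppr_eq0 oner_eq0.
Qed.

End Module.

(** * Special values *)

Section Special.
Variables (C : numClosedFieldType) (n : nat) (hn : (5 <= n)%N) (s : C).
Local Notation rv := (@rv C n).
Local Notation o1 := (o1 hn).
Local Notation o2 := (o2 hn).
Local Notation oa := (oa hn).
Local Notation ob := (ob hn).

Lemma Cms_module_exists : exists (V : lmodType C) (rho : 'M[C]_(n + n) -> V -> V) (v0 : V),
  [/\ is_gmod rho, is_Cms_vec s rho v0 &
    forall q (j : 'I_n), mid q -> (j < n - 2)%N -> rho (rv q (lshift n j)) v0 != 0].
Proof.
pose Ix := (bool * ('I_(n + n) * 'I_(n + n)))%type.
have K : cancel (@enum_rank Ix) (@enum_val Ix predT) := @enum_rankK Ix.
exists {mpoly C[#|{: Ix}|]}, (frame_rho (@enum_rank Ix) (@enum_val Ix predT) s), 1.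
split; [exact: frame_rho_gmod K s|exact: frame_rho_Cms|].
by move=> q j mq lj; apply: (frame_rho_neq0 K).
Qed.

Lemma n_ge2 : (2 <= n)%N. Proof. by lia. Qed.

Lemma conf_inv_nu0 : conf_inv s (nu0 hn) <-> s = 1.
Proof.
have n2 := n_ge2; have l1 := o1_lt hn; have ml := mid_oa hn; split=> [hc|s1].
  have [V [rho [v0 [hrho hv0 nz]]]] := Cms_module_exists.
  (* A generated submodule contains its generators, so one explicit lowest weight tensor can be
     tested. *)
  have hW : Wstar (nu0 hn) (lowtens0 C hn) by move=> P _ _ _ hl; apply: hl; apply: lowtens0_low.
  have := hc _ hW _ (in_n_rv C l1 ml) _ _ _ hrho hv0.
  have sx := so_rv C (lshift n o1) (lshift n oa).
  rewrite (omega2E hrho) (rhoZr hrho) // (symact_nu0 (lowtens0_low C hn)) lowtens0_val (rhoZr hrho) //.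
  rewrite (x_casimir n2 hrho hv0 l1 ml l1) eqxx mul1r !scalerA.
  move: (kap C n) (kap_neq0 C n2) => k /negbTE k0 /eqP; rewrite scaler_eq0.
  rewrite (negbTE (nz _ _ _ l1)) ?mid_cj // orbF !mulf_eq0 !invr_eq0 k0 !pnatr_eq0 /=.
  have -> : (n - 3 == 0)%N = false by lia.
  by rewrite -[X in X - _]mulr1 -mulrBr mulf_eq0 pnatr_eq0 /= subr_eq0 eq_sym => /eqP.
subst s; apply: conf_inv_low => // T hT V rho v0 hrho hv0 X hX.
have sX := in_n_so hX; rewrite (symact_nu0 hT) (rhoZr hrho) //.
rewrite (in_n_kill n2 hrho) ?scaler0 // => j p lj mp.
by rewrite (x_casimir n2 hrho hv0 lj mp l1) mulr1 subrr mulr0 scale0r.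
Qed.

Lemma conf_inv_nu1 b : b = lshift n ob \/ b = rshift n ob -> conf_inv s (nu1 hn b) <-> s = 1.
Proof.
move=> hb; have [ma mb ab acb] := ab_facts hb.
have n2 := n_ge2; have l1 := o1_lt hn; have l2 := o2_lt hn; split=> [hc|s1].
  have [V [rho [v0 [hrho hv0 nz]]]] := Cms_module_exists.
  have hW : Wstar (nu1 hn b) (lowtens1 C hn b) by move=> P _ _ _ hl; apply: hl; apply: lowtens1_low.
  have := hc _ hW _ (in_n_rv C l1 ma) _ _ _ hrho hv0.
  have sx := so_rv C (lshift n o1) (rshift n oa).
  rewrite (omega2E hrho) (rhoZr hrho) // (symact_nu1 hb (lowtens1_low C hb) hrho) lowtens1_val // (rhoZr hrho) //.
  (* With X indexed by (1, a), only the first of the four terms survives: 1 - s times f(b, 2) v0. *)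
  rewrite (x_wedge hrho hv0 l1 ma l1 l2) // !eqxx (negbTE ab) !mulr0 mulr1 mul0r !scale0r scale1r ?addr0 ?subr0.
  rewrite !scalerA; move: (kap C n) (kap_neq0 C n2) => k /negbTE k0 /eqP; rewrite scaler_eq0.
  rewrite (negbTE (nz _ _ mb l2)) orbF !mulf_eq0 !invr_eq0 k0 !pnatr_eq0 /= subr_eq0 eq_sym.
  by move/eqP.
subst s; apply: conf_inv_low => // T hT V rho v0 hrho hv0 X hX.
have sX := in_n_so hX; rewrite (symact_nu1 hb hT hrho) (rhoZr hrho) //.
rewrite (in_n_kill n2 hrho) ?scaler0 // => j p lj mp.
by rewrite (x_wedge hrho hv0 lj mp l1 l2) // subrr scale0r.
Qed.

End Special.

(** * Counting the roots of g(1) whose difference from nu is a root *)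

Section Count.
Variables (n : nat) (hn : (5 <= n)%N).
Local Notation o1 := (o1 hn).
Local Notation o2 := (o2 hn).
Local Notation oa := (oa hn).
Local Notation ob := (ob hn).

Lemma ee_oa : ee n (n - 1) = wt (lshift n oa).
Proof. by rewrite wtl /=; congr (ee n _); lia. Qed.

Lemma ee_ob : ee n n = wt (lshift n ob).
Proof. by rewrite wtl /=; congr (ee n _); lia. Qed.

Lemma ee_o1 : ee n 1 = wt (lshift n o1). Proof. by rewrite wtl. Qed.
Lemma ee_o2 : ee n 2 = wt (lshift n o2). Proof. by rewrite wtl. Qed.

Lemma mem_Dg1 (w : weight n) : reflect
  (exists2 x : 'I_n * 'I_(n + n), g1idx x & w = wt (lshift n x.1) - wt x.2) (w \in Dg1 n).
Proof.
rewrite mem_undup; apply: (iffP flattenP) => [[l /mapP[j]]|[[j q] /andP[/= lj mq] ->]].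
  rewrite mem_iota => /andP[j1 jn] -> /flattenP[l' /mapP[k hk ->] /mapP[b _ ->]].
  have lj : (j.-1 < n)%N by lia.
  have ej : ee n j = wt (lshift n (Ordinal lj)) by rewrite wtl /= prednK.
  pose k' := if k == n then ob else oa.
  have ek : ee n k = wt (lshift n k').
    rewrite /k'; move: hk; rewrite !inE => /orP[]/eqP->.
      have -> : (n - 1 == n)%N = false by lia.
      exact: ee_oa.
    by rewrite eqxx ee_ob.
  exists (Ordinal lj, if b then rshift n k' else lshift n k').
    rewrite /g1idx /=; apply/andP; split; first lia.
    have mk : mid (lshift n k') by rewrite /k'; case: ifP => _; [exact: mid_ob|exact: mid_oa].
    by case: b => //; rewrite -cjl mid_cj.
  by rewrite ej ek /=; case: b; rewrite // -cjl wt_cj opprK.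
exists (flatten [seq [seq ee n j.+1 + (if b then ee n k else - ee n k) | b <- [:: true; false]]
   | k <- [:: (n - 1)%N; n]]).
  by apply/mapP; exists j.+1 => //; rewrite mem_iota; lia.
rewrite wtl; have [k hk hq] := midE hn mq.
have [k0 hk0 ek0] : exists2 k0, k0 \in [:: (n - 1)%N; n] & ee n k0 = wt (lshift n k).
  by case: hk => ->; [exists (n - 1)%N; rewrite ?ee_oa ?inE ?eqxx|exists n; rewrite ?ee_ob ?inE ?eqxx ?orbT].
apply/flattenP; exists [seq ee n j.+1 + (if b then ee n k0 else - ee n k0) | b <- [:: true; false]].
  by apply/mapP; exists k0.
apply/mapP; case: hq => ->; [exists false|exists true]; rewrite ?ek0 //.
by rewrite -cjl wt_cj opprK.
Qed.

Lemma isRoot_wt (p q : 'I_(n + n)) : p != q -> p != cj q -> isRoot (wt p + wt q).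
Proof.
have H (j k : 'I_n) (u v : bool) : (j < k)%N ->
    isRoot ((if u then ee n j.+1 else - ee n j.+1) + (if v then ee n k.+1 else - ee n k.+1)).
  move=> jk; apply/existsP; exists j; apply/existsP; exists k; rewrite jk /=.
  by case: u; case: v; rewrite eqxx ?orbT.
have G (j k : 'I_n) (u v : bool) : j != k ->
    isRoot ((if u then ee n j.+1 else - ee n j.+1) + (if v then ee n k.+1 else - ee n k.+1)).
  by rewrite -val_eqE neq_ltn => /orP[jk|kj]; [exact: H|rewrite addrC; exact: H].
case: (split_ordP p) => j ->; case: (split_ordP q) => k ->; rewrite ?cjl ?cjr ?wtl ?wtr
  ?eq_lshift ?eq_rshift ?eq_lrshift ?eq_rlshift => n1 n2'.
- exact: (G j k true true).
- exact: (G j k true false).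
- exact: (G j k false true).
- exact: (G j k false false).
Qed.

(** The two obstructions by which the counts reject a candidate: a coordinate of size 2, or a third
    nonzero coordinate. *)
Lemma isRoot_small (w : weight n) : isRoot w ->
  (forall i, `|w i| <= 1) /\
  (forall i j k : 'I_n, i != j -> i != k -> j != k -> w i != 0 -> w j != 0 -> w k = 0).
Proof.
case/existsP=> a /existsP[b /andP[ab h]].
have nab : (a == b) = false by rewrite -val_eqE ltn_eqF.
have [e1 [e2 [h1 h2 we]]] : exists e1 e2 : int, [/\ `|e1| = 1, `|e2| = 1 &
    forall i, w i = e1 * (i == a)%:Z + e2 * (i == b)%:Z].
  case/or4P: h => /eqP ->; [exists 1, 1|exists 1, (-1)|exists (-1), 1|exists (-1), (-1)];
    by split=> // i; rewrite !ffunE ?mul1r ?mulN1r.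
have w0 i : w i != 0 -> i = a \/ i = b.
  by rewrite we; have [->|_] := eqVneq i a; [left|have [->|_] := eqVneq i b; [right|rewrite !mulr0]].
split=> [i|i j k ij ik jk wi wj].
  rewrite we; have [->|_] := eqVneq i a; first by rewrite nab mulr0 addr0 mulr1 h1.
  by rewrite mulr0 add0r; case: (i == b); rewrite ?mulr1 ?h2 // mulr0.
apply/eqP; apply: contraTT isT => wk; move: ij ik jk.
by case: (w0 _ wi) => ->; case: (w0 _ wj) => ->; case: (w0 _ wk) => ->; rewrite ?eqxx.
Qed.

Lemma g1wt_inj (x y : 'I_n * 'I_(n + n)) : g1idx x -> g1idx y ->
  wt (lshift n x.1) - wt x.2 = wt (lshift n y.1) - wt y.2 -> x = y.
Proof.
case: x y => [j q] [k r] /andP[/= lj mq] /andP[/= lk mr] e.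
have := congr1 (fun w : weight n => w j) e; rewrite !ffunE (wt_mid mq lj) (wt_mid mr lj) !wtE.
rewrite !eq_lshift !eq_lrshift eqxx; have [ekj _|//] := eqVneq k j.
by move: e; rewrite ekj => /addrI/oppr_inj/wt_inj ->.
Qed.

(** Counting moves from weights to index pairs, on which the weight map is injective by
    [g1wt_inj]. *)
Lemma size_Delta_nu (nu : weight n) (L : seq ('I_n * 'I_(n + n))) :
  uniq L -> {in L, forall x, g1idx x} ->
  (forall x, g1idx x -> isRoot (nu - (wt (lshift n x.1) - wt x.2)) = (x \in L)) ->
  size (Delta_nu nu) = size L.
Proof.
move=> uL gL hL; pose g (x : 'I_n * 'I_(n + n)) := wt (lshift n x.1) - wt x.2.
rewrite -(size_map g L); apply/perm_size/uniq_perm.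
- by rewrite filter_uniq ?undup_uniq.
- by rewrite map_inj_in_uniq // => x y /gL gx /gL gy; apply: g1wt_inj.
move=> w; rewrite mem_filter; apply/andP/mapP => [[rw /mem_Dg1[x gx ew]]|[x xL ->]].
  by exists x => //; rewrite -hL // -ew.
by split; [rewrite hL ?gL|apply/mem_Dg1; exists x; rewrite ?gL].
Qed.

Lemma size_nu0 : size (Delta_nu (nu0 hn)) = 4.
Proof.
have nab : (oa == ob) = false by rewrite -val_eqE /=; lia.
have nba : (ob == oa) = false by rewrite eq_sym.
have l1 := o1_lt hn; have ml := mid_oa hn; have ml' := mid_ob hn.
have mr : mid (rshift n oa) by rewrite -cjl mid_cj.
have mr' : mid (rshift n ob) by rewrite -cjl mid_cj.
apply: (size_Delta_nu (L := [:: (o1, lshift n oa); (o1, rshift n oa); (o1, lshift n ob); (o1, rshift n ob)])).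
- rewrite /= !inE !xpair_eqE !eqxx ?eq_lshift ?eq_rshift ?eq_lrshift ?eq_rlshift ?nab //.
- by move=> x; rewrite !inE => /or4P[]/eqP->; rewrite /g1idx /= l1.
case=> j q /andP[/= lj mq]; have [->|nj] := eqVneq j o1.
  have -> : nu0 hn - (wt (lshift n o1) - wt q) = wt (lshift n o1) + wt q.
    by apply/ffunP => i; rewrite !ffunE; ring.
  rewrite isRoot_wt.
  - by have [k [] -> [] ->] := midE hn mq; rewrite !inE !xpair_eqE !eqxx ?orbT.
  - by rewrite eq_sym mid_lF.
  - by rewrite eq_sym mid_lF ?mid_cj.
have -> : ((j, q) \in [:: (o1, lshift n oa); (o1, rshift n oa); (o1, lshift n ob); (o1, rshift n ob)]) = false.
  by rewrite !inE !xpair_eqE (negbTE nj).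
(* For j other than 1 the coordinate of eps_1 is still 2. *)
apply/negbTE/negP => rt; have [big _] := isRoot_small rt; move: (big o1).
by rewrite !ffunE (wt_mid mq l1) !wtE !eq_lshift !eq_lrshift eqxx (negbTE nj).
Qed.

Lemma size_nu1 b : b = lshift n ob \/ b = rshift n ob -> size (Delta_nu (nu1 hn b)) = 4.
Proof.
move=> hb; have [ma mb ab acb] := ab_facts hb; set a := rshift n oa in ma ab acb.
have nab : (oa == ob) = false by rewrite -val_eqE /=; lia.
have nba : (ob == oa) = false by rewrite eq_sym.
have l1 := o1_lt hn; have l2 := o2_lt hn.
have o12 : (o1 == o2) = false by [].
have o21 : (o2 == o1) = false by [].
apply: (size_Delta_nu (L := [:: (o1, a); (o1, b); (o2, a); (o2, b)])).
- by rewrite /= !inE !xpair_eqE !eqxx o12 (negbTE ab).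
- by move=> x; rewrite !inE => /or4P[]/eqP->; rewrite /g1idx /= ?l1 ?l2.
have key (k : 'I_n) q : (k < n - 2)%N -> mid q ->
    isRoot (wt (lshift n k) - wt a - wt b + wt q) = (q == a) || (q == b).
  move=> lk mq; have root (c : 'I_(n + n)) : mid c -> isRoot (wt (lshift n k) + wt (cj c)).
    move=> mc; have mc' : mid (cj c) by rewrite mid_cj.
    by apply: isRoot_wt; rewrite eq_sym ?cjK mid_lF.
  have [->|nqa] := eqVneq q a.
    rewrite orTb; have -> : wt (lshift n k) - wt a - wt b + wt a = wt (lshift n k) + wt (cj b).
      by rewrite wt_cj; apply/ffunP => i; rewrite !ffunE; ring.
    exact: root.
  have [->|nqb] := eqVneq q b.
    have -> : wt (lshift n k) - wt a - wt b + wt b = wt (lshift n k) + wt (cj a).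
      by rewrite wt_cj; apply/ffunP => i; rewrite !ffunE; ring.
    by rewrite root.
  (* Here q is cj a or cj b, which produces a coordinate 2 or -2. *)
  apply/negbTE/negP => rt; have [big _] := isRoot_small rt.
  have := big oa; have := big ob; rewrite !ffunE.
  have F (c : 'I_n) : (n - 2 <= c)%N -> wt (lshift n k) c = 0.
    by move=> lc; rewrite wtE eq_lshift eq_lrshift -val_eqE ltn_eqF // (leq_trans lk).
  have la : (n - 2 <= oa)%N by [].
  have lb : (n - 2 <= ob)%N := leq_sub2l n (isT : (1 <= 2)%N).
  rewrite (F _ la) (F _ lb).
  move: nqa nqb; have [c hc hq] := midE hn mq; rewrite !wtE /a.
  by case: hc => hc; case: hq => ->; rewrite hc; case: hb => ->;
    rewrite ?eq_lshift ?eq_rshift ?eq_lrshift ?eq_rlshift ?nab ?nba ?eqxx.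
case=> j q /andP[/= lj mq]; have [->|nj1] := eqVneq j o1.
  have -> : nu1 hn b - (wt (lshift n o1) - wt q) = wt (lshift n o2) - wt a - wt b + wt q.
    by apply/ffunP => i; rewrite !ffunE; ring.
  by rewrite key // !inE !xpair_eqE eqxx o12 !orbF.
have [->|nj2] := eqVneq j o2.
  have -> : nu1 hn b - (wt (lshift n o2) - wt q) = wt (lshift n o1) - wt a - wt b + wt q.
    by apply/ffunP => i; rewrite !ffunE; ring.
  by rewrite key // !inE !xpair_eqE eqxx o21.
have -> : ((j, q) \in [:: (o1, a); (o1, b); (o2, a); (o2, b)]) = false.
  by rewrite !inE !xpair_eqE (negbTE nj1) (negbTE nj2).
(* The coordinates 1, 2 and j are all nonzero. *)
apply/negbTE/negP => rt; have [_ small] := isRoot_small rt; move: (small o1 o2 j).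
rewrite o12 (eq_sym o1) (eq_sym o2) nj1 nj2 => /(_ isT isT isT).
rewrite !ffunE !(wt_mid mq) ?(wt_mid ma) ?(wt_mid mb) // !wtE !eq_lshift !eq_lrshift !eqxx.
by rewrite o12 o21 (negbTE nj1) (negbTE nj2) !(eq_sym _ j) (negbTE nj1) (negbTE nj2) => /(_ isT isT).
Qed.

(** The index b carries the sign opposite to that of eps_n, since [nu1] subtracts [wt b]. *)
Lemma mu_epsi (i : 'I_3) : mu n + epsi n i = nu0 hn \/
  exists2 b, b = lshift n ob \/ b = rshift n ob & mu n + epsi n i = nu1 hn b.
Proof.
case: i => [[|[|[|//]]] lti]; rewrite /mu /epsi /= ee_oa ee_o1 ?ee_o2 ?ee_ob.
- by left; apply/ffunP => k; rewrite !ffunE; ring.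
- right; exists (rshift n ob); first by right.
  by rewrite /nu1 -!cjl !wt_cj; apply/ffunP => k; rewrite !ffunE; ring.
- right; exists (lshift n ob); first by left.
  by rewrite /nu1 -!cjl !wt_cj; apply/ffunP => k; rewrite !ffunE; ring.
Qed.

End Count.

Theorem theorem3p1 (C : numClosedFieldType) (n : nat) (hn : (5 <= n)%N)
    (i : 'I_3) (s : C) :
  conf_inv s (mu n + epsi n i) <->
  s = (size (Delta_nu (mu n + epsi n i)))%:R / 2%:R - 1.
Proof.
have four : 4%:R / 2%:R - 1 = 1 :> C by field.
case: (mu_epsi hn i) => [->|[b hb ->]].
  by rewrite size_nu0 four; apply: conf_inv_nu0.
by rewrite size_nu1 // four; apply: conf_inv_nu1.
Qed.
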